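(* Let $K\in\{2,3,\dots\}$, $\mathbf{w}=(w_1,\dots,w_K)\in\Delta_K$, $r\in(-1,\infty)$, and $w:=\max_{k=1,\dots,K}w_k$. The merging function $(r+1)^{1/r}M_{r,\mathbf{w}}$ on $[0,1]^K$ is precise if and only if $w\le1/2$ and $r\in\left[\frac{w}{1-w},\frac{1-w}{w}\right]$. Here $(r+1)^{1/r}$ is understood as $e$ when $r=0$.
   Context: $\Delta_K:=\{(w_1,\dots,w_K)\in[0,1]^K\mid w_1+\dots+w_K=1\}$. Weighted generalized means on $[0,1]^K$: for $r\in\mathbb{R}\setminus\{0\}$, $M_{r,\mathbf{w}}(p_1,\dots,p_K):=\left(w_1p_1^r+\dots+w_Kp_K^r\right)^{1/r}$, and (as the limit $r\to0$) $M_{0,\mathbf{w}}(p_1,\dots,p_K):=\exp(w_1\ln p_1+\dots+w_K\ln p_K)$; conventions: $0^c:=\infty$ and $\infty^c:=0$ for $c<0$, $0^c:=0$ for $c>0$, $\ln0:=-\infty$, $\exp(-\infty):=0$, $0\cdot(\pm\infty):=0$. Fix an atomless probability space and let $\mathcal{U}$ be the set of all random variables on it uniformly distributed on $[0,1]$. A merging function is a Borel function $F:[0,1]^K\to[0,\infty)$, increasing (in the weak sense) in each argument, such that for each $\epsilon\in(0,1)$, $\sup\{\mathbb{P}(F(U_1,\dots,U_K)\le\epsilon)\mid U_1,\dots,U_K\in\mathcal{U}\}\le\epsilon$. It is precise if this supremum equals $\epsilon$ for each $\epsilon\in(0,1)$. (For $r\in(-1,\infty)$ the function $(r+1)^{1/r}M_{r,\mathbf{w}}$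 is a merging function.) *)

(* Defs.v *)
From mathcomp Require Export all_boot all_order all_algebra.
From mathcomp Require Export all_classical all_reals all_analysis.
From mathcomp Require Export measurable_realfun.
Set Implicit Arguments.
Unset Strict Implicit.
Unset Printing Implicit Defensive.
Import Order.TTheory GRing.Theory Num.Theory.
Import numFieldNormedType.Exports.
Local Open Scope classical_set_scope.
Local Open Scope ring_scope.

Definition simplex (R : realType) (K : nat) : set (K.-tuple R) :=
  [set w | (forall k, 0 <= tnth w k <= 1) /\ \sum_(k < K) tnth w k = 1].

(* The starting value 0 is harmless, as weights are nonnegative. *)
Definition max_weight (R : realType) (K : nat) (w : K.-tuple R) : R :=
  \big[Num.max/0]_(k < K) tnth w k.

Definition unit_cube (R : realType) (K : nat) : set (K.-tuple R) :=
  [set p | forall k, 0 <= tnth p k <= 1].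

(* x ^ c for x in [0, +oo] and c != 0. The library's poweR is not used as it
   is, because it has 0 `^ c = 0 and +oo `^ c = +oo also for c < 0. *)
Definition epow (R : realType) (x : \bar R) (c : R) : \bar R :=
  if c < 0 then
    if x == 0%E then +oo%E else if x == +oo%E then 0%E else poweR x c
  else poweR x c.

(* The remaining conventions are those of the library: lne 0 = -oo,
   expeR -oo = 0 and 0 * +oo = 0 * -oo = 0. *)
Definition gen_mean (R : realType) (K : nat) (r : R) (w p : K.-tuple R)
    : \bar R :=
  (if r == 0%R then
     expeR (\sum_(k < K) (tnth w k)%:E * lne (tnth p k)%:E)
   else
     epow (\sum_(k < K) (tnth w k)%:E * epow (tnth p k)%:E r) r^-1)%E.

Definition mean_factor (R : realType) (r : R) : R :=
  if r == 0 then expR 1 else (r + 1) `^ r^-1.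

Definition scaled_mean (R : realType) (K : nat) (r : R) (w p : K.-tuple R)
    : \bar R :=
  ((mean_factor r)%:E * gen_mean r w p)%E.

Definition atomless (d : measure_display) (T : measurableType d)
    (R : realType) (P : probability T R) : Prop :=
  forall A : set T, measurable A -> (0 < P A)%E ->
    exists B : set T,
      [/\ measurable B, B `<=` A, (0 < P B)%E & (P B < P A)%E].

(* The values are required to lie in [0, 1] everywhere, not just almost
   surely, so that a function on the cube can be applied to them. *)
Definition uniform01 (d : measure_display) (T : measurableType d)
    (R : realType) (P : probability T R) (U : {RV P >-> R}) : Prop :=
  (forall t, 0 <= U t <= 1) /\
  (forall A : set R, measurable A ->
    distribution P U A = uniform_prob (@ltr01 R) A).

(* No constraint on the joint law of the U_k. *)
Definition sup_prob_le (d : measure_display) (T : measurableType d)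
    (R : realType) (P : probability T R) (K : nat)
    (F : K.-tuple R -> \bar R) (e : R) : \bar R :=
  ereal_sup [set P [set t | (F [tuple U k t | k < K] <= e%:E)%E] |
    U in [set U : 'I_K -> {RV P >-> R} | forall k, uniform01 (U k)]].

(* Only the restriction of F to the cube matters; it takes values in
   [0, +oo[. *)
Definition merging_function (d : measure_display) (T : measurableType d)
    (R : realType) (P : probability T R) (K : nat)
    (F : K.-tuple R -> \bar R) : Prop :=
  [/\ forall p, unit_cube p -> (0 <= F p < +oo)%E,
      measurable_fun (@unit_cube R K) F,
      forall (p q : K.-tuple R) (k : 'I_K), unit_cube p -> unit_cube q ->
        (forall j, j != k -> tnth p j = tnth q j) ->
        tnth p k <= tnth q k -> (F p <= F q)%E
    & forall e : R, 0 < e < 1 -> (sup_prob_le P F e <= e%:E)%E].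

Definition precise_merging_function (d : measure_display)
    (T : measurableType d) (R : realType) (P : probability T R) (K : nat)
    (F : K.-tuple R -> \bar R) : Prop :=
  merging_function P F /\
  (forall e : R, 0 < e < 1 -> sup_prob_le P F e = e%:E).

(* Main.v *)
Require Import Defs.
From mathcomp Require Import ring lra zify.
Set Implicit Arguments.
Unset Strict Implicit.
Unset Printing Implicit Defensive.
Import Order.TTheory GRing.Theory Num.Theory.
Import numFieldNormedType.Exports.
Local Open Scope classical_set_scope.
Local Open Scope ring_scope.

(** Let m = 1/(r+1), the mean of U^r for U uniform on [0,1], and let w be the
    largest weight.

    Sufficiency.  For r > 0 the mean is at most e if and only if
    sum_k w_k U_k^r <= m e^r, and m e^r is the mean of the left-hand side when
    every U_k is uniform on [0,e].  So the probability e is approached as soon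
    as variables uniform on [0,e] can be coupled so that sum_k w_k U_k^r is
    nearly constant; by homogeneity e = 1 suffices.  For r >= 1 the law of U^r
    has a decreasing density on [0,1] and mean m; for r <= 1 this holds for
    1 - U^r with mean 1 - m.  Laws with decreasing densities on intervals
    [0,w_k] can be coupled with a constant sum if and only if no w_k exceeds
    the sum of their means, that is w <= m in the first case and w <= 1 - m in
    the second.  These are w(r+1) <= 1 and w(r+1) <= r; each of them implies
    the other one in its own range of r, and together they are the condition
    of the theorem ([exponent_intervalE]).

    The coupling is built on integer grids, up to bounded errors that vanish
    after rescaling, as a finite list of weighted points.  Uniform laws on
    intervals whose lengths satisfy the polygon inequality have a coupling
    with constant sum ([polygon]).  A decreasing density has drops, and a drop
    at c allows one to remove a small multiple of a uniform law on [l,c)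
    without losing monotonicity.  The drops can be chosen so that, for suitable
    l, these uniform laws satisfy the polygon inequality and have the right
    total mean ([heavy_selection], [block]); the remainder satisfies the same
    hypotheses with a smaller mass ([extract_block]), and the iteration
    exhausts all the mass but an arbitrarily small part ([joint_mixability]).
    The discretised laws of U^r are treated in [discrete_mix] and
    [mean_power_boxes]; the result is a finite mixture of boxes with uniform
    margins.  On an atomless space there is a uniform variable
    ([uniform_source]), and every such mixture is realised by gluing affine
    functions of it ([realise_boxes], [near_precise]).

    Validity and necessity.  Let phi u = - u^r / r (- ln u for r = 0).  On the
    event that the mean is at most e, sum_k w_k (phi(U_k) - phi(e)) is at least
    gap = e^r/(r+1), which is also the mean of phi - phi(e) over [0,e].  Taking
    expectations of positive parts bounds the probability of the event by e.
    Replacing the k-th positive part by gap on an interval [0,s_k]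
    ([dual_bound], [mean_event_bound]) changes the bound for
    gap * probability by the sum of gap s_k - w_k loss(s_k), where loss(s) is
    the integral of phi - phi(e) over [0,s].  As s tends to 0, loss(s)/s tends
    to phi(0) - phi(e), which is infinite for r <= 0 and e^r/r for r > 0.
    Hence the bound drops below e if r <= 0, and if r > 0 and r < w(r+1).  If
    r > 0 and 1 < w(r+1), the event forces the variable of largest weight below
    some number smaller than e. *)

(** * Weighted points and three uniform laws *)

Lemma sum_divn (V : zmodType) (q l : nat) (F : nat -> V) :
  \sum_(0 <= u < q * l) F (u %/ q)%N = (\sum_(0 <= i < l) F i) *+ q.
Proof.
have [->|q0] := posnP q; first by rewrite mul0n big_geq// mulr0n.
elim: l => [|l IHl]; first by rewrite muln0 !big_geq// mul0rn.
rewrite big_nat_recr//= mulrnDl -IHl mulnS addnC.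
rewrite (big_cat_nat _ (n := (q * l)%N)) //= ?leq_addr//; congr (_ + _).
rewrite -{1}[(q * l)%N]add0n big_addn addnC addnK.
under eq_big_nat => i /andP[_ iq] do rewrite addnC mulnC divnMDl// divn_small// addn0.
by rewrite sumr_const_nat subn0.
Qed.

Lemma sum_divn_rev (V : zmodType) (q l z : nat) (F : nat -> V) :
  \sum_(0 <= u < q * l) F (z + l - 1 - u %/ q)%N
  = (\sum_(z <= i < z + l) F i) *+ q.
Proof.
rewrite (sum_divn q l (fun i => F (z + l - 1 - i)%N)).
rewrite -{2}[z]add0n big_addn addKn [in RHS]big_nat_rev /=.
congr (_ *+ _); apply: eq_big_nat => i /andP[_ il]; congr F; lia.
Qed.

Section plans.
Context {R : realFieldType}.

(** A finite law on integer points is a list of weighted points; its [k]-th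
    margin is tested against arbitrary functions, so that masses need not be
    grouped by value. *)
Definition pexp (I : Type) (s : seq (R * (I -> nat))) (k : I) (F : nat -> R) : R :=
  \sum_(p <- s) p.1 * F (p.2 k).

Lemma pexp_cat I (s t : seq (R * (I -> nat))) k F :
  pexp (s ++ t) k F = pexp s k F + pexp t k F.
Proof. by rewrite /pexp big_cat. Qed.

(** The segment from [(0, z + x, y)] to [(x + y, z, 0)], on which the sum is
    constant: the uniform parameter [u] has [x * y * (x + y)] values so that each
    coordinate runs uniformly through its interval.  The function [f] permutes
    the three coordinates. *)
Definition edge (c : R) (x y z : nat) (f : nat -> nat -> nat -> nat -> nat)
   : seq (R * (nat -> nat)) :=
  [seq (c / (x + y)%:R, f (u %/ (x * y))%N
            (z + x - 1 - u %/ (y * (x + y)))%N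
            (0 + y - 1 - u %/ (x * (x + y)))%N) | u <- index_iota 0 (x * y * (x + y))].

Lemma edge_up c x y z (f : nat -> nat -> nat -> nat -> nat) i F :
  (forall a b d, f a b d i = a) ->
  pexp (edge c x y z f) i F
  = c * (x * y)%:R / (x + y)%:R * \sum_(0 <= i < x + y) F i.
Proof.
move=> fi; rewrite /pexp /edge big_map /=.
under eq_bigr do rewrite fi.
by rewrite -big_distrr/= sum_divn -[_ *+ (x * y)%N]mulr_natl; ring.
Qed.

Lemma edge_dn1 c x y z (f : nat -> nat -> nat -> nat -> nat) i F :
  (0 < x + y)%N ->
  (forall a b d, f a b d i = b) ->
  pexp (edge c x y z f) i F
  = c * y%:R * \sum_(z <= i < z + x) F i.
Proof.
move=> xy fi; rewrite /pexp /edge big_map /=.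
under eq_bigr do rewrite fi.
have -> : (x * y * (x + y) = (y * (x + y)) * x)%N by lia.
rewrite -big_distrr/= sum_divn_rev -[_ *+ (y * _)%N]mulr_natl natrM.
by field; rewrite -natrD pnatr_eq0 -lt0n.
Qed.

Lemma edge_dn2 c x y z (f : nat -> nat -> nat -> nat -> nat) i F :
  (0 < x + y)%N ->
  (forall a b d, f a b d i = d) ->
  pexp (edge c x y z f) i F
  = c * x%:R * \sum_(0 <= i < y) F i.
Proof.
move=> xy fi; rewrite /pexp /edge big_map /=.
under eq_bigr do rewrite fi.
have -> : (x * y * (x + y) = (x * (x + y)) * y)%N by lia.
rewrite -big_distrr/= sum_divn_rev add0n -[_ *+ (x * _)%N]mulr_natl natrM.
by field; rewrite -natrD pnatr_eq0 -lt0n.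
Qed.

(** Each coordinate is the exact one rounded down by at most 1. *)
Lemma edge_sum c x y z (f : nat -> nat -> nat -> nat -> nat) :
  0 <= c ->
  (forall a b d, f a b d 0 + f a b d 1 + f a b d 2 = a + b + d)%N ->
  all (fun p => (0 <= p.1) &&
     (x + y + z <= p.2 0 + p.2 1 + p.2 2 + 3 <= x + y + z + 3)%N) (edge c x y z f).
Proof.
move=> c0 fs; rewrite /edge all_map; apply/allP => u.
rewrite mem_index_iota => /andP[_ ultM] /=.
rewrite divr_ge0//= fs.
set a := (_ %/ (x * y))%N; set b := (u %/ (y * _))%N; set d := (u %/ (x * _))%N.
have [x0 y0] : (0 < x)%N /\ (0 < y)%N by split; nia.
have xy0 : (0 < x * y)%N by rewrite muln_gt0 x0.
have b1 : (b * (y * (x + y)) <= u)%N by rewrite leq_divM.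
have b2 : (u < b.+1 * (y * (x + y)))%N by rewrite ltn_ceil// muln_gt0 y0 addn_gt0 x0.
have d1 : (d * (x * (x + y)) <= u)%N by rewrite leq_divM.
have d2 : (u < d.+1 * (x * (x + y)))%N by rewrite ltn_ceil// muln_gt0 x0 addn_gt0 x0.
have bx : (b < x)%N by rewrite /b ltn_divLR ?muln_gt0 ?y0 ?addn_gt0 ?x0//; nia.
have dy : (d < y)%N by rewrite /d ltn_divLR ?muln_gt0 ?x0 ?addn_gt0 ?x0//; nia.
have ba : (b + d <= a)%N.
  rewrite /a leq_divRL// -(@leq_pmul2r (x + y)) ?addn_gt0 ?x0//.
  have := leq_add (leq_mul b1 (leqnn x)) (leq_mul d1 (leqnn y)).
  lia.
have ab : (a < b + d + 2)%N.
  rewrite /a ltn_divLR// -(@ltn_pmul2r (x + y)) ?addn_gt0 ?x0//.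
  have h1 : (u * x < b.+1 * (y * (x + y)) * x)%N by rewrite ltn_pmul2r.
  have h2 : (u * y < d.+1 * (x * (x + y)) * y)%N by rewrite ltn_pmul2r.
  have := leq_add h1 (ltnW h2); lia.
by move: ba ab bx dy; clearbody a b d; clear; lia.
Qed.

Definition tri (a b d : nat) (i : nat) : nat :=
  match i with 0 => a | 1 => b | _ => d end.

(** Three uniform laws on intervals satisfying the triangle inequality can be
    coupled with constant sum.  With [al], [be], [de] the lengths for which
    the intervals are [de + be], [al + de] and [be + al], the coupling moves
    on the sides of the triangle with vertices [(0, al + de, be)],
    [(de + be, al, 0)] and [(de, 0, al + be)] of the plane of sum [H].  On
    two sides a coordinate covers complementary parts of its interval, on the
    third one the whole interval; the weights [be * de], [al * be],
    [al * de] make the three densities constant. *)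
Lemma triangle (S : nat -> nat) (H : nat) :
  (S 0 + S 1 + S 2 = 2 * H)%N ->
  (forall i, (i < 3)%N -> (0 < S i <= H)%N) ->
  exists s : seq (R * (nat -> nat)),
    all (fun p => (0 <= p.1) &&
      (H <= p.2 0 + p.2 1 + p.2 2 + 3 <= H + 3)%N) s /\
    forall i F, (i < 3)%N ->
      pexp s i F = (S i)%:R^-1 * \sum_(0 <= j < S i) F j.
Proof.
move=> SH Sb.
have /andP[S0 S0H] := Sb 0%N isT; have /andP[S1 S1H] := Sb 1%N isT.
have /andP[S2 S2H] := Sb 2%N isT.
set al := (H - S 0)%N; set be := (H - S 1)%N; set de := (H - S 2)%N.
have E0 : S 0%N = (de + be)%N by lia.
have E1 : S 1%N = (al + de)%N by lia.
have E2 : S 2%N = (be + al)%N by lia.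
have EH : H = (al + be + de)%N by lia.
set W : R := (al * be + be * de + al * de)%:R.
have W0 : 0 < W by rewrite ltr0n; nia.
set c := W^-1; have c0 : 0 <= c by rewrite invr_ge0 ltW.
have wcE : c * (al%:R * be%:R + be%:R * de%:R + al%:R * de%:R) = 1.
  by rewrite -!natrM -!natrD -/W mulVf// gt_eqF.
pose f0 a b d := tri a b d; pose f2 a b d := tri b d a.
pose f1 a b d := tri d a b.
exists (edge c de be al f0 ++ edge c be al de f2 ++ edge c al de be f1); split.
  have h1 := @edge_sum c de be al f0 c0.
  have h2 := @edge_sum c be al de f2 c0.
  have h3 := @edge_sum c al de be f1 c0.
  have e1 : (de + be + al = H)%N by lia.
  have e2 : (be + al + de = H)%N by lia.
  have e3 : (al + de + be = H)%N by lia.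
  rewrite e1 in h1; rewrite e2 in h2; rewrite e3 in h3.
  rewrite !all_cat h1 ?h2 ?h3//= => *; lia.
have P0 : (de + be)%:R != 0 :> R by rewrite pnatr_eq0; lia.
have P1 : (al + de)%:R != 0 :> R by rewrite pnatr_eq0; lia.
have P2 : (be + al)%:R != 0 :> R by rewrite pnatr_eq0; lia.
have d0 : (0 < de + be)%N by lia.
have d1 : (0 < al + de)%N by lia.
have d2 : (0 < be + al)%N by lia.
move=> [|[|[|//]]] F _; rewrite !pexp_cat.
- rewrite (edge_up _ _ _ _ (f := f0))// (edge_dn1 _ _ _ (f := f2))//.
  rewrite (edge_dn2 _ _ _ (f := f1))// E0.
  rewrite [in LHS](big_cat_nat _ (n := de)) ?leq_addr//=.
  rewrite [in RHS](big_cat_nat _ (n := de)) ?leq_addr//=.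
  set X := \sum_(0 <= j < de) _; set Y := \sum_(de <= j < _) _.
  transitivity (c * (al%:R * be%:R + be%:R * de%:R + al%:R * de%:R) *
    ((de + be)%:R^-1 * (X + Y))).
    by rewrite natrM natrD; field; rewrite -natrD.
  by rewrite wcE mul1r.
- rewrite (edge_up _ _ _ _ (f := f1))// (edge_dn1 _ _ _ (f := f0))//.
  rewrite (edge_dn2 _ _ _ (f := f2))// E1.
  rewrite [in LHS](big_cat_nat _ (m := 0%N) (n := al) (p := (al + de)%N)) ?leq_addr//=.
  rewrite [in RHS](big_cat_nat _ (n := al)) ?leq_addr//=.
  set X := \sum_(0 <= j < al) _; set Y := \sum_(al <= j < _) _.
  transitivity (c * (al%:R * be%:R + be%:R * de%:R + al%:R * de%:R) *
    ((al + de)%:R^-1 * (X + Y))).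
    by rewrite natrM natrD; field; rewrite -natrD.
  by rewrite wcE mul1r.
- rewrite (edge_up _ _ _ _ (f := f2))// (edge_dn1 _ _ _ (f := f1))//.
  rewrite (edge_dn2 _ _ _ (f := f0))// E2.
  rewrite [in LHS](big_cat_nat _ (m := 0%N) (n := be) (p := (be + al)%N)) ?leq_addr//=.
  rewrite [in RHS](big_cat_nat _ (n := be)) ?leq_addr//=.
  set X := \sum_(0 <= j < be) _; set Y := \sum_(be <= j < _) _.
  transitivity (c * (al%:R * be%:R + be%:R * de%:R + al%:R * de%:R) *
    ((be + al)%:R^-1 * (X + Y))).
    by rewrite natrM natrD; field; rewrite -natrD.
  by rewrite wcE mul1r.
Qed.

End plans.

(** * The polygon inequality *)

Lemma sum_three (I : finType) (g : I -> nat) (F : I -> nat) :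
  (forall k, g k < 3)%N ->
  (\sum_k F k = \sum_(k | g k == 0) F k + \sum_(k | g k == 1) F k
                 + \sum_(k | g k == 2) F k)%N.
Proof.
move=> g3; rewrite (bigID (fun k => g k == 0%N) predT) /= -addnA.
congr (_ + _)%N; rewrite (bigID (fun k => g k == 1%N)) /=; congr (_ + _)%N.
  by apply: eq_bigl => k; case: (g k) => [|[|]].
by apply: eq_bigl => k; move: (g3 k); case: (g k) => [|[|[|]]].
Qed.

(** Lengths that are at most half of their total can be grouped into three
    consecutive blocks with the same property: the middle one is the single
    length at which the partial sums reach half of the total. *)
Lemma three_groups (K : nat) (s : 'I_K -> nat) (H : nat) :
  (3 <= K)%N -> (forall k, 0 < s k <= H)%N -> (\sum_k s k = 2 * H)%N ->
  exists g : 'I_K -> nat, (forall k, g k < 3)%N /\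
    forall i, (i < 3)%N -> (0 < \sum_(k | g k == i) s k <= H)%N.
Proof.
move=> K3 sH sE.
pose pref q := (\sum_(k < K | (k < q)%N) s k)%N.
have prefK : pref K = (2 * H)%N.
  by rewrite -sE; apply: eq_bigl => k; rewrite ltn_ord.
(* The middle block is the first index other than 0 at which the partial sums
   reach [H]; excluding 0 keeps the first block nonempty. *)
pose P q := (0 < q)%N && (H <= pref q.+1)%N.
have exP : exists q, P q.
  exists K.-1; rewrite /P prednK ?prefK; last lia.
  by apply/andP; split; lia.
have prefS q (qK : (q < K)%N) : pref q.+1 = (s (Ordinal qK) + pref q)%N.
  rewrite /pref (bigD1 (Ordinal qK)) //=; congr (_ + _)%N.
  by apply: eq_bigl => k; rewrite ltnS andbC ltn_neqAle.
case: (ex_minnP exP) => p /andP[p0 Hp] pmin.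
have pK : (p < K)%N.
  have: P K.-1.
    by rewrite /P prednK ?prefK; lia.
  by move=> /pmin; lia.
have prefp : (0 < pref p)%N.
  have K0 : (0 < K)%N by lia.
  rewrite /pref (bigD1 (Ordinal K0)) //=.
  by rewrite addn_gt0; case/andP: (sH (Ordinal K0)) => ->.
have prefpH : (pref p <= H)%N.
  have [p1|p1] := leqP p 1.
    have -> : p = 1%N by lia.
    have K0 : (0 < K)%N by lia.
    rewrite (prefS 0%N K0) /pref big1 ?addn0; first by case/andP: (sH (Ordinal K0)).
    by move=> k; rewrite ltn0.
  rewrite leqNgt; apply/negP => Hlt.
  have : P p.-1 by rewrite /P prednK//; apply/andP; split; [lia|exact: ltnW].
  by move=> /pmin; lia.
have [sp0 spH] := andP (sH (Ordinal pK)).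
pose g (k : 'I_K) := if (k < p)%N then 0%N else if (k == p :> nat) then 1%N else 2%N.
have g3 k : (g k < 3)%N by rewrite /g; case: ifP => //; case: ifP.
have g0 : (\sum_(k | g k == 0%N) s k)%N = pref p.
  by apply: eq_bigl => k; rewrite /g; case: ifP => //; case: ifP.
have g1 : (\sum_(k | g k == 1%N) s k)%N = s (Ordinal pK).
  rewrite (big_pred1 (Ordinal pK)) // => k; rewrite /g /=.
  rewrite -val_eqE /=; case: ltngtP => //.
have gsum : (pref p + s (Ordinal pK) + \sum_(k | g k == 2%N) s k = 2 * H)%N.
  by rewrite -sE -g1 -g0 (sum_three s g3).
have Hp' : (H <= s (Ordinal pK) + pref p)%N by rewrite -(prefS p pK).
have g2 : (0 < \sum_(k | g k == 2%N) s k)%N.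
  rewrite lt0n; apply/negP => /eqP g20; rewrite g20 addn0 in gsum.
  have sp : s (Ordinal pK) = H by lia.
  have pp : pref p = H by lia.
  have pK1 : p = K.-1.
    apply/eqP; rewrite eqn_leq; apply/andP; split; first by lia.
    rewrite leqNgt; apply/negP => pltK.
    have pK' : (p.+1 < K)%N by lia.
    move: g20; rewrite (bigD1 (Ordinal pK')) /=; last by rewrite /g /=; case: ltngtP => //; lia.
    by case/andP: (sH (Ordinal pK')) => + _; lia.
  have p2 : (1 < p)%N by lia.
  have : ~~ P p.-1 by apply/negP => /pmin; lia.
  rewrite /P prednK// pp leqnn andbT; lia.
exists g; split=> //.
move=> [|[|[|//]]] _; [rewrite g0|rewrite g1|]; lia.
Qed.

Section polygon.
Context {R : realFieldType}.

(** The point [p.2] has sum [H] up to the rounding error of [polygon]. *)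
Definition near_plane (K H : nat) (p : R * ('I_K -> nat)) :=
  (0 <= p.1) && (H <= \sum_k p.2 k + (K + 3) <= H + (K + 3))%N.

(** The coordinates of a group are made proportional to a single uniform
    variable on the total length of the group, which reduces to three
    coordinates.  All lengths are first multiplied by the product [Q] of the
    [s k], so that the proportions are exact. *)
Lemma polygon (K : nat) (s : 'I_K -> nat) (H : nat) :
  (3 <= K)%N -> (forall k, 0 < s k <= H)%N -> (\sum_k s k = 2 * H)%N ->
  exists t : seq (R * ('I_K -> nat)),
    all (near_plane H) t /\
    forall k F, pexp t k F = (s k)%:R^-1 * \sum_(0 <= j < s k) F j.
Proof.
move=> K3 sH sE.
have [g [g3 gS]] := three_groups K3 sH sE.
pose S i := (\sum_(k | g k == i) s k)%N.
pose Q := (\prod_k s k)%N.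
pose q k := (\prod_(j | j != k) s j)%N.
have Qq k : Q = (s k * q k)%N by rewrite /Q /q (bigD1 k).
have q0 k : (0 < q k)%N by rewrite prodn_gt0// => j; case/andP: (sH j).
have Q0 : (0 < Q)%N by rewrite prodn_gt0// => j; case/andP: (sH j).
have sumE : (S 0 + S 1 + S 2 = 2 * H)%N.
  by rewrite -sE (sum_three s g3).
have SQ : (S 0 * Q + S 1 * Q + S 2 * Q = 2 * (H * Q))%N by nia.
have SQb i : (i < 3)%N -> (0 < S i * Q <= H * Q)%N.
  by move=> /gS /andP[h1 h2]; rewrite muln_gt0 h1 Q0 leq_mul2r h2 orbT.
have [t [tgood tE]] := @triangle R (fun i => (S i * Q)%N) (H * Q)%N SQ SQb.
exists [seq (p.1, fun k => (p.2 (g k) %/ (S (g k) * q k))%N) | p <- t]; split; last first.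
  move=> k F; rewrite /pexp big_map /=.
  have := tE (g k) (fun j => F (j %/ (S (g k) * q k))%N) (g3 k).
  rewrite /pexp => ->.
  have -> : (S (g k) * Q = (S (g k) * q k) * s k)%N by rewrite (Qq k); lia.
  rewrite sum_divn -[_ *+ (S (g k) * q k)%N]mulr_natl.
  case/andP: (gS _ (g3 k)) => Sg0 _; case/andP: (sH k) => sk0 _.
  have := q0 k; rewrite !natrM mulrA => qk0; congr (_ * _).
  by field; rewrite !pnatr_eq0 -!lt0n sk0 qk0 Sg0.
rewrite all_map; apply: sub_all tgood => -[w x] /= /andP[w0 /andP[lo hi]].
rewrite /near_plane /= w0 /=.
set y := fun k => (x (g k) %/ (S (g k) * q k))%N.
have Sg0 k : (0 < S (g k))%N by case/andP: (gS _ (g3 k)).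
have y1 k : (y k * (S (g k) * Q) <= x (g k) * s k)%N.
  rewrite (Qq k) [leqLHS](_ : _ = y k * (S (g k) * q k) * s k)%N; last by lia.
  by rewrite leq_mul2r leq_divM orbT.
have y2 k : (x (g k) * s k <= (y k + 1) * (S (g k) * Q))%N.
  rewrite (Qq k) [leqRHS](_ : _ = (y k).+1 * (S (g k) * q k) * s k)%N; last by lia.
  by rewrite leq_mul2r ltnW ?orbT// ltn_ceil// muln_gt0 Sg0 q0.
have grp i : (i < 3)%N -> ((\sum_(k | g k == i) y k) * Q <= x i <= 
     (\sum_(k | g k == i) (y k + 1)) * Q)%N.
  move=> i3; have Si0 : (0 < S i)%N by case/andP: (gS _ i3).
  apply/andP; split; rewrite -(@leq_pmul2r (S i))//.
    rewrite -mulnA {1}big_distrl /= [(x i * _)%N]big_distrr /=.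
    by apply: leq_sum => k /eqP <-; rewrite [(Q * _)%N]mulnC y1.
  rewrite -mulnA big_distrl /= [(x i * _)%N]big_distrr /=.
  by apply: leq_sum => k /eqP <-; rewrite [(Q * _)%N]mulnC y2.
have /andP[a0 b0] := grp 0%N isT; have /andP[a1 b1] := grp 1%N isT.
have /andP[a2 b2] := grp 2%N isT.
have up : ((\sum_k y k) * Q <= H * Q)%N by rewrite (sum_three _ g3) !mulnDl; lia.
have dn : (H * Q <= (\sum_k (y k + 1)) * Q + 3)%N by rewrite (sum_three _ g3) !mulnDl; lia.
rewrite leq_pmul2r// in up.
rewrite big_split /= sum1_card card_ord in dn.
rewrite leq_add2r up andbT leqNgt; apply/negP => lt.
move: dn lt Q0; rewrite -/(\sum_k y k)%N; move: (\sum_k y k)%N => Y dn lt Q0.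
have := leq_mul lt (leqnn Q).
move: dn; rewrite mulSn !mulnDl; clear -Q0; lia.
Qed.
End polygon.

(** * Extracting a block from decreasing densities *)

Lemma sum_between (I : finType) (lo up : I -> nat) (L : nat) :
  (forall k, lo k <= up k)%N -> (\sum_k lo k <= L <= \sum_k up k)%N ->
  exists l : I -> nat, (forall k, lo k <= l k <= up k)%N /\ (\sum_k l k = L)%N.
Proof.
move=> + /andP[+ Lup]; move e : (L - \sum_k lo k)%N => m.
elim: m lo e => [|m IH] lo e lou loL.
  by exists lo; split; [move=> k; rewrite leqnn lou | lia].
have [k ltk] : exists k, (lo k < up k)%N.
  apply/existsP; apply: contraT; rewrite negb_exists => /forallP h.
  have : (\sum_k up k <= \sum_k lo k)%N by apply: leq_sum => k _; rewrite leqNgt h.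
  by lia.
pose lo' j := if j == k then (lo k).+1 else lo j.
have lo'E : (\sum_k lo' k = (\sum_k lo k).+1)%N.
  rewrite (bigD1 k)//= [in RHS](bigD1 k)//= /lo' eqxx addSn; congr (_ + _).+1.
  by apply: eq_bigr => j /negbTE ->.
have [|j||] := IH lo'; rewrite ?lo'E; try lia.
- by rewrite /lo'; case: eqP => [->|].
- move=> l [ll lL]; exists l; split=> // j; have := ll j.
  by rewrite /lo'; case: eqP => [->|//] /andP[/ltnW -> ->].
Qed.

(** Given the right ends [c k], the left ends [l k] have to satisfy
    [\sum_k l k = L], so that the midpoints have sum [C], and
    [c k - l k <= C - L], the polygon inequality.  The latter is a lower bound
    [lo k] on [l k].  The sum of the [lo k] is at most [L]: this is clear if
    at most one of them is positive, and if two are, their sum plus the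
    remaining [c k] is [2 * L - 2 * C + \sum_k c k = L].  The upper bounds
    [l k < c k] leave enough room because [n + K <= C]. *)
Lemma block (R : realFieldType) (K n C : nat) (c : 'I_K -> nat) :
  (3 <= K)%N -> (n + K <= C)%N -> (forall k, 0 < c k <= n)%N ->
  (\sum_k c k <= 2 * C <= \sum_k c k + n)%N ->
  exists l : 'I_K -> nat, [/\ (forall k, l k < c k)%N,
    (\sum_k (c k + l k) = 2 * C)%N &
    exists t : seq (R * ('I_K -> nat)),
    all (near_plane C) t /\
    forall k F, pexp t k F = (c k - l k)%:R^-1 * \sum_(l k <= j < c k) F j].
Proof.
move=> K3 nC cn /andP[cC Cc].
pose L := (2 * C - \sum_k c k)%N.
have Ln : (L <= n)%N by lia.
pose lo k := (L - (C - c k))%N; pose up k := (c k).-1.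
have loup k : (lo k <= up k)%N by rewrite /lo /up; have := cn k; lia.
have loc k : (lo k <= c k)%N by rewrite /lo; have := cn k; lia.
have loL k : (lo k <= L)%N by rewrite /lo; lia.
have sumlo : (\sum_k lo k <= L)%N.
  have [k lk|h] := pickP (fun k => 0 < lo k)%N; last first.
    by rewrite big1// => k _; apply/eqP; rewrite -leqn0 leqNgt h.
  rewrite (bigD1 k)//=.
  have [j /andP[jk lj]|h] := pickP (fun j => (j != k) && (0 < lo j))%N; last first.
    rewrite big1 ?addn0// => j jk; apply/eqP; rewrite -leqn0 leqNgt.
    by have := h j; rewrite jk /= => ->.
  rewrite (bigD1 j)//=.
  have : (\sum_k c k = c k + (c j + \sum_(i | (i != k) && (i != j)) c i))%N.
    by rewrite (bigD1 k)//= (bigD1 j).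
  have : (\sum_(i | (i != k) && (i != j)) lo i <=
          \sum_(i | (i != k) && (i != j)) c i)%N by apply: leq_sum.
  have := cn k; have := cn j; move: lk lj; rewrite /lo /L.
  set A := (\sum_(i | _) (_ - _))%N; set B := (\sum_(i | _) c i)%N; set S := (\sum_i c i)%N.
  by move: A B => A B; move: cC Cc Ln; rewrite /L -/S; clear; lia.
have sumup : (L <= \sum_k up k)%N.
  have : (\sum_k c k = \sum_k up k + K)%N.
    rewrite -[X in (_ + X)%N]card_ord -sum1_card -big_split /=.
    by apply: eq_bigr => k _; rewrite /up addn1 prednK//; case/andP: (cn k).
  by lia.
have [|l [ll lE]] := @sum_between _ lo up L loup; first by rewrite sumlo.
have lc k : (l k < c k)%N by have := ll k; have := cn k; rewrite /up; lia.
have sE : (\sum_k (c k - l k) = 2 * (C - L))%N.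
  have : (\sum_k (c k - l k) + \sum_k l k = \sum_k c k)%N.
    by rewrite -big_split /=; apply: eq_bigr => k _; rewrite subnK// ltnW.
  by lia.
have sH k : (0 < c k - l k <= C - L)%N.
  by have := ll k; have := lc k; have := cn k; rewrite /lo; lia.
have [t [tg tE]] := @polygon R K (fun k => c k - l k)%N _ K3 sH sE.
exists l; split=> //; first by rewrite big_split /= lE /L subnKC.
exists [seq (p.1, fun k => (p.2 k + l k)%N) | p <- t]; split.
  rewrite all_map; apply: sub_all tg => -[v x] /andP[v0 /andP[h1 h2]].
  rewrite /near_plane /= v0 /= big_split /= lE.
  by move: h1 h2 Ln nC; clear; set S := (\sum_k x k)%N; lia.
move=> k F; rewrite /pexp big_map /=.
have := tE k (fun i => F (i + l k)%N); rewrite /pexp => ->.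
by rewrite -[X in _ = _ * \sum_(X <= _ < _) _]add0n big_addn.
Qed.

Section heavy.
Context {R : realFieldType}.

(** A nonincreasing [rho] that vanishes at [n] is the mixture of the uniform laws
    on the initial segments of length [i + 1], with masses
    [(i + 1) (rho i - rho (i + 1))]; the next two lemmas express the total mass
    and the first moment in this way. *)
Lemma abel_sum (n : nat) (G : nat -> R) (rho : nat -> R) : G 0%N = 0 ->
  \sum_(0 <= i < n) G i.+1 * (rho i - rho i.+1) + G n * rho n
  = \sum_(0 <= i < n) (G i.+1 - G i) * rho i.
Proof.
move=> G0; elim: n => [|n IH]; first by rewrite !big_geq// G0; ring.
by rewrite !big_nat_recr//= -IH; ring.
Qed.

Lemma abel_sum1 (n : nat) (rho : nat -> R) : rho n = 0 ->
  \sum_(i < n) i.+1%:R * (rho i - rho i.+1) = \sum_(i < n) rho i.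
Proof.
move=> rn; have := @abel_sum n (fun i => i%:R) rho erefl.
rewrite rn mulr0 addr0 !big_mkord => ->.
by apply: eq_bigr => i _; rewrite -natr1; ring.
Qed.

Lemma abel_sum2 (n : nat) (rho : nat -> R) : rho n = 0 ->
  \sum_(i < n) i.+1%:R ^+ 2 * (rho i - rho i.+1)
  = \sum_(i < n) (2 * i + 1)%:R * rho i.
Proof.
move=> rn; have := @abel_sum n (fun i => i%:R ^+ 2) rho (expr0n _ 2).
rewrite rn mulr0 addr0 !big_mkord => ->.
by apply: eq_bigr => i _; rewrite -natr1 (natrD _ (2 * i)) natrM; ring.
Qed.

(** Drops below [th * M] carry at most [n ^ 2 * th * M] of the mass, so up to
    small errors the mean is between its values for the shortest and for the
    longest initial segment that ends at a drop of at least [th * M]. *)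
Lemma heavy_drops (n : nat) (rho : nat -> R) (M th : R) :
  (forall i, rho i.+1 <= rho i) -> rho n = 0 -> \sum_(i < n) rho i = M ->
  0 < M -> 0 < th -> n%:R ^+ 2 * th < 1 ->
  exists a b : 'I_n,
   [/\ th * M <= rho a - rho a.+1, th * M <= rho b - rho b.+1,
       a.+1%:R * (M - n%:R ^+ 2 * th * M) <= \sum_(i < n) (2 * i + 1)%:R * rho i &
       \sum_(i < n) (2 * i + 1)%:R * rho i <= b.+1%:R * M + n%:R ^+ 3 * th * M].
Proof.
move=> rdec rn rM M0 th0 thn.
pose d (i : 'I_n) := rho i - rho i.+1.
have d0 i : 0 <= d i by rewrite subr_ge0.
pose hv (i : 'I_n) := th * M <= d i.
have SM : \sum_(i < n) i.+1%:R * d i = M by rewrite abel_sum1.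
have Slight : \sum_(i < n | ~~ hv i) i.+1%:R * d i <= n%:R ^+ 2 * th * M.
  apply: (@le_trans _ _ (\sum_(i < n) n%:R * (th * M))); last first.
    by rewrite sumr_const card_ord -(mulr_natl (n%:R * _)) expr2 !mulrA.
  rewrite [leRHS](bigID hv)/=; apply: ler_wpDl.
    by apply: sumr_ge0 => i _; rewrite !mulr_ge0// ltW.
  apply: ler_sum => i; rewrite /hv -ltNge => /ltW di.
  by apply: ler_pM => //; rewrite ler_nat.
have Sheavy : M - n%:R ^+ 2 * th * M <= \sum_(i < n | hv i) i.+1%:R * d i.
  by move: SM; rewrite (bigID hv)/=; lra.
have Sheavy1 : \sum_(i < n | hv i) i.+1%:R * d i <= M.
  rewrite -SM [leRHS](bigID hv)/= ler_wpDr// sumr_ge0// => i _.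
  by rewrite mulr_ge0.
have [i0 hi0] : exists i, hv i.
  apply/existsP; apply: contraT; rewrite negb_exists => /forallP h.
  move: Sheavy; rewrite big_pred0 => [|i]; last by rewrite (negbTE (h i)).
  have := mulr_gt0 M0 (_ : 0 < 1 - n%:R ^+ 2 * th); rewrite subr_gt0 => /(_ thn); lra.
have [a ha amin] := arg_minnP (fun i : 'I_n => i : nat) hi0.
have [b hb bmax] := arg_maxnP (fun i : 'I_n => i : nat) hi0.
have SE : \sum_(i < n) (2 * i + 1)%:R * rho i = \sum_(i < n) i.+1%:R ^+ 2 * d i.
  by rewrite abel_sum2.
exists a, b; rewrite SE; split => //.
  apply: (@le_trans _ _ (\sum_(i < n | hv i) i.+1%:R ^+ 2 * d i)); last first.
    rewrite [leRHS](bigID hv)/= ler_wpDr// sumr_ge0// => i _.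
    by apply: mulr_ge0; [exact: sqr_ge0|exact: d0].
  apply: (@le_trans _ _ (a.+1%:R * \sum_(i < n | hv i) i.+1%:R * d i)).
    by rewrite ler_wpM2l.
  rewrite big_distrr /=; apply: ler_sum => i hi.
  by rewrite expr2 mulrA ler_wpM2r// ler_wpM2r// ler_nat ltnS; exact: amin.
rewrite (bigID hv)/=; apply: lerD.
  apply: (@le_trans _ _ (b.+1%:R * \sum_(i < n | hv i) i.+1%:R * d i)).
    rewrite big_distrr /=; apply: ler_sum => i hi.
    by rewrite expr2 mulrA ler_wpM2r// ler_wpM2r// ler_nat ltnS; exact: bmax.
  by rewrite ler_wpM2l.
apply: (@le_trans _ _ (n%:R * \sum_(i < n | ~~ hv i) i.+1%:R * d i)).
  rewrite big_distrr /=; apply: ler_sum => i _.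
  by rewrite expr2 mulrA ler_wpM2r// ler_wpM2r// ler_nat.
have -> : n%:R ^+ 3 * th * M = n%:R * (n%:R ^+ 2 * th * M) by ring.
by rewrite ler_wpM2l.
Qed.

(** The shortest segments have total length at most [2 * C] and the longest
    ones at least [2 * C]: these are integers and the errors of [heavy_drops]
    are less than 1 in total.  Among the choices of drops with total at most
    [2 * C], take one of largest total; enlarging one further coordinate would
    exceed [2 * C], so the total is within [n] of it. *)
Lemma heavy_selection (K n C : nat) (rho : 'I_K -> nat -> R) (M th : R) :
  (forall k i, rho k i.+1 <= rho k i) -> (forall k, rho k n = 0) ->
  (forall k, \sum_(i < n) rho k i = M) ->
  \sum_k \sum_(i < n) (2 * i + 1)%:R * rho k i = (2 * C)%:R * M ->
  0 < M -> 0 < th -> (2 * C + 1)%:R * n%:R ^+ 2 * th < 1 ->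
  K%:R * n%:R ^+ 3 * th < 1 ->
  exists c : 'I_K -> nat, [/\ forall k, (0 < c k <= n)%N,
    forall k, th * M <= rho k (c k).-1 - rho k (c k) &
    (\sum_k c k <= 2 * C <= \sum_k c k + n)%N].
Proof.
move=> rdec rn rM rmean M0 th0 thC thK.
have thn : n%:R ^+ 2 * th < 1.
  apply: le_lt_trans thC; rewrite -mulrA ler_peMl ?ler1n ?addn1//.
  by rewrite mulr_ge0 ?exprn_ge0// ltW.
have hd k := heavy_drops (rdec k) (rn k) (rM k) M0 th0 thn.
have [a /fin_all_exists[b Hab]] := fin_all_exists hd; clear hd.
have suma : (\sum_k (a k).+1 <= 2 * C)%N.
  rewrite leqNgt; apply/negP => h.
  have : (\sum_k (a k).+1)%:R * (M - n%:R ^+ 2 * th * M) <= (2 * C)%:R * M.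
    rewrite -rmean natr_sum big_distrl /=; apply: ler_sum => k _.
    by case: (Hab k).
  have : (2 * C + 1)%:R <= (\sum_k (a k).+1)%:R :> R by rewrite ler_nat addn1.
  set A := (\sum_k _)%:R; move: thC; rewrite natrD => thC.
  have -> : M - n%:R ^+ 2 * th * M = (1 - n%:R ^+ 2 * th) * M by ring.
  rewrite mulrA ler_pM2r// => AC AC'.
  have := ler_wpM2r (_ : 0 <= 1 - n%:R ^+ 2 * th) AC; rewrite subr_ge0 ltW// => /(_ isT).
  move: thC AC'; rewrite natrM; set c := C%:R; set N := n%:R ^+ 2 * th.
  rewrite -mulrA -/N; lra.
have sumb : (2 * C <= \sum_k (b k).+1)%N.
  rewrite leqNgt; apply/negP => h.
  have : (2 * C)%:R * M <= (\sum_k (b k).+1)%:R * M + K%:R * (n%:R ^+ 3 * th * M).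
    rewrite -rmean natr_sum big_distrl /= mulr_natl -[K in _ *+ K]card_ord -sumr_const -big_split /=.
    by apply: ler_sum => k _; case: (Hab k).
  have : (\sum_k (b k).+1)%:R + 1 <= (2 * C)%:R :> R by rewrite natr1 ler_nat.
  set B := (\sum_k _)%:R; move=> h1 h2.
  have : (2 * C)%:R * M < (2 * C)%:R * M.
    apply: le_lt_trans h2 _; apply: (@lt_le_trans _ _ ((B + 1) * M)).
      rewrite mulrDl mul1r ltrD2l mulrA [K%:R * _]mulrA.
      by rewrite -[X in _ < X]mul1r ltr_pM2r.
    by rewrite ler_pM2r.
  by rewrite ltxx.
pose ok (f : {ffun 'I_K -> 'I_n}) :=
  [forall k, th * M <= rho k (f k) - rho k (f k).+1] &&
  (\sum_k (f k).+1 <= 2 * C)%N.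
have ok0 : ok [ffun k => a k].
  apply/andP; split; first by apply/forallP => k; rewrite ffunE; case: (Hab k).
  by under eq_bigr do rewrite ffunE.
have [f /andP[/forallP hf fC] fmax] :=
  arg_maxnP (fun f : {ffun 'I_K -> 'I_n} => \sum_k (f k : nat))%N ok0.
exists (fun k => (f k).+1); split=> //.
  by move=> k; rewrite ltn_ord.
rewrite fC /= leqNgt; apply/negP => lt.
have [k fk] : exists k, (f k < b k)%N.
  apply/existsP; apply: contraT; rewrite negb_exists => /forallP h.
  have : (\sum_k (b k).+1 <= \sum_k (f k).+1)%N.
    by apply: leq_sum => k _; rewrite ltnS leqNgt h.
  by move=> /(leq_trans sumb) /(leq_trans lt); rewrite ltnNge leq_addr.
pose f' := [ffun j => if j == k then b k else f j].
have f'E (h : nat -> nat) : (\sum_j h (f' j) + h (f k) = \sum_j h (f j) + h (b k))%N.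
  rewrite (bigD1 k)//= [in RHS](bigD1 k)//= !ffunE eqxx.
  under eq_bigr => j jk do rewrite ffunE (negbTE jk).
  by rewrite addnAC [RHS]addnAC; congr (_ + _)%N; exact: addnC.
have : ok f'.
  apply/andP; split.
    apply/forallP => j; rewrite ffunE; case: eqP => [->|_]; last exact: hf.
    by case: (Hab k).
  move: (f'E succn) (ltn_ord (b k)) lt; clear.
  by set A := (\sum_j succn (f' j))%N; set B := (\sum_j succn (f j))%N; lia.
move/fmax; move: (f'E id) fk; clear; rewrite /=.
by set A := (\sum_j f' j)%N; set B := (\sum_j f j)%N; lia.
Qed.
End heavy.

Section iterate.
Context {R : realFieldType}.

(** In the moment condition [i] stands for the cell [[i, i+1)], of midpoint
    [i + 1/2]: the means of the normalised margins have sum [C]. *)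
Definition monotone_margins (K n C : nat) (M : R) (rho : 'I_K -> nat -> R) :=
  [/\ forall k i, rho k i.+1 <= rho k i,
      forall k i, (n <= i)%N -> rho k i = 0,
      forall k, \sum_(i < n) rho k i = M &
      \sum_k \sum_(i < n) (2 * i + 1)%:R * rho k i = (2 * C)%:R * M].

Lemma monotone_margins_ge0 K n C M (rho : 'I_K -> nat -> R) k i :
  monotone_margins n C M rho -> 0 <= rho k i.
Proof.
case=> rdec rn _ _; have [ni|ni] := leqP n i; first by rewrite rn.
rewrite -(rn k n)// -(subnKC (ltnW ni)).
elim: (n - i)%N => [|m IH]; first by rewrite addn0.
by rewrite addnS (le_trans (rdec _ _)).
Qed.

Definition unif (l c : nat) (i : nat) : R :=
  if (l <= i < c)%N then (c - l)%:R^-1 else 0.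

Lemma unif_out (c i : nat) : (c <= i)%N -> unif 0 c i = 0.
Proof. by move=> ci; rewrite /unif /= ltnNge ci. Qed.

Lemma unif_nonincreasing (c i : nat) : unif 0 c i.+1 <= unif 0 c i.
Proof.
rewrite /unif /=; case: ifP => h1; case: ifP => h2; rewrite ?invr_ge0//.
by have := ltnW h1; rewrite h2.
Qed.

Lemma sum_unif (l c n : nat) (F : nat -> R) : (l < c)%N -> (c <= n)%N ->
  \sum_(i < n) unif l c i * F i = (c - l)%:R^-1 * \sum_(l <= i < c) F i.
Proof.
move=> lc cn; rewrite -(big_mkord predT (fun i => unif l c i * F i)).
rewrite (big_cat_nat _ (n := l)) //=; last by lia.
rewrite [X in _ + X](big_cat_nat _ (n := c)) //=; last exact: ltnW.
rewrite big_nat big1 ?add0r => [|i /andP[_ il]]; last first.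
  by rewrite /unif leqNgt il mul0r.
rewrite [X in _ + X]big_nat [X in _ + X]big1 ?addr0 => [|i /andP[ci _]]; last first.
  by rewrite /unif [(i < c)%N]ltnNge ci andbF mul0r.
rewrite big_distrr; apply: eq_big_nat => i lic.
by rewrite /unif lic.
Qed.

Lemma sum_double_succ (l c : nat) : (l <= c)%N ->
  \sum_(l <= i < c) (2 * i + 1)%:R = (c ^ 2)%:R - (l ^ 2)%:R :> R.
Proof.
move=> /subnKC <-; elim: (c - l)%N => [|m IH]; first by rewrite addn0 big_geq ?subrr.
by rewrite addnS big_nat_recr ?leq_addr//= IH (natrD _ (2 * _)) natrM !natrX -natr1; ring.
Qed.

(** Subtracting [th * M] times the uniform law on [[l k, c k)] keeps the
    density decreasing: at [l k] it only goes down further, and at [c k] the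
    drop of at least [th * M] absorbs the upward step.  The moment condition
    survives because the midpoints of the removed intervals have sum [C]. *)
Lemma extract_block (K n C : nat) (M th : R) (rho : 'I_K -> nat -> R) :
  (3 <= K)%N -> (n + K <= C)%N -> monotone_margins n C M rho ->
  0 < M -> 0 < th -> (2 * C + 1)%:R * n%:R ^+ 2 * th < 1 ->
  K%:R * n%:R ^+ 3 * th < 1 ->
  exists (t : seq (R * ('I_K -> nat))) (rho' : 'I_K -> nat -> R),
    [/\ all (near_plane C) t, monotone_margins n C ((1 - th) * M) rho' &
    forall k F, pexp t k F + \sum_(i < n) rho' k i * F i
              = \sum_(i < n) rho k i * F i].
Proof.
move=> K3 nC rhoM M0 th0 thC thK; have [rdec rn rM rmean] := rhoM.
have [c [cn hc cC]] :=
  heavy_selection rdec (fun k => rn k n (leqnn n)) rM rmean M0 th0 thC thK.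
have [l [lc lE [t [tg tE]]]] := @block R K n C c K3 nC cn cC.
have th_ge0 : 0 <= th * M by rewrite mulr_ge0 ?ltW.
pose rho' k i := rho k i - th * M * unif (l k) (c k) i.
have cn' k : (c k <= n)%N by case/andP: (cn k).
have sumF k (F : nat -> R) : \sum_(i < n) rho' k i * F i = \sum_(i < n) rho k i * F i -
    th * M * ((c k - l k)%:R^-1 * \sum_(l k <= i < c k) F i).
  rewrite -(sum_unif F (lc k) (cn' k)) big_distrr -sumrB; apply: eq_bigr => i _.
  by rewrite /rho' /=; ring.
exists [seq (th * M * p.1, p.2) | p <- t], rho'; split.
- rewrite all_map; apply: sub_all tg => p /andP[p0 pp].
  by rewrite /near_plane /= pp mulr_ge0.
- split.
  + move=> k i; rewrite /rho' /unif.
    have ckl : (0 < c k - l k)%N by rewrite subn_gt0.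
    have u1 : (c k - l k)%:R^-1 <= 1 :> R by rewrite invf_le1 ?ler1n ?ltr0n.
    have u0 : 0 <= (c k - l k)%:R^-1 :> R by rewrite invr_ge0.
    have := rdec k i; have := hc k.
    have [li|li] := boolP (l k <= i < c k)%N; last first.
      rewrite mulr0 subr0 => _ rd; apply: le_trans rd.
      by case: ifP => _; rewrite ?mulr0 ?subr0// gerBl mulr_ge0.
    have [li'|li'] := boolP (l k <= i.+1 < c k)%N; first by move=> _; rewrite lerD2r.
    have ci : c k = i.+1 by move: li li'; lia.
    have := ler_wpM2l th_ge0 u1; rewrite mulr1 ci mulr0 subr0 /=.
    by set x := th * M * _; lra.
  + move=> k i ni; rewrite /rho' rn// /unif.
    have -> : (l k <= i < c k)%N = false by have := cn' k; lia.
    by rewrite mulr0 subr0.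
  + move=> k; have := sumF k (fun=> 1).
    under eq_bigr do rewrite mulr1.
    under [in RHS]eq_bigr do rewrite mulr1.
    rewrite rM => ->; rewrite sumr_const_nat mulVf; first by ring.
    by rewrite pnatr_eq0 subn_eq0 -ltnNge.
  + rewrite (eq_bigr (fun k => \sum_(i < n) (2 * i + 1)%:R * rho k i - th * M * (c k + l k)%:R)).
      by rewrite sumrB rmean -big_distrr /= -natr_sum lE; ring.
    move=> k _; under eq_bigr do rewrite mulrC.
    rewrite (sumF k (fun i => (2 * i + 1)%:R)) (sum_double_succ (ltnW (lc k))).
    congr (_ - _ * _); first by apply: eq_bigr => i _; rewrite mulrC.
    rewrite (natrX _ (c k) 2) (natrX _ (l k) 2) (natrD _ (c k) (l k)) (natrB _ (ltnW (lc k))).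
    have : (c k)%:R - (l k)%:R != 0 :> R by rewrite subr_eq0 eqr_nat gtn_eqF.
    by move=> ?; field.
- move=> k F; rewrite sumF -tE /pexp big_map /=.
  by under eq_bigr do rewrite -mulrA; rewrite -big_distrr /=; ring.
Qed.

(** The mass left after finitely many extractions is coupled independently; only
    its amount matters. *)
Lemma product_plan (K n : nat) (M : R) (rho : 'I_K -> nat -> R) :
  0 < M -> (forall k i, 0 <= rho k i) -> (forall k, \sum_(i < n) rho k i = M) ->
  exists t : seq (R * ('I_K -> nat)), all (fun p => 0 <= p.1) t /\
    forall k F, pexp t k F = \sum_(i < n) rho k i * F i.
Proof.
move=> M0 r0 rM.
exists [seq ((M ^+ K.-1)^-1 * \prod_k rho k (f k), (fun k => f k : nat))
       | f : {ffun 'I_K -> 'I_n} <- index_enum {ffun 'I_K -> 'I_n}].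
split.
  rewrite all_map; apply/allP => f _ /=.
  by rewrite mulr_ge0 ?prodr_ge0// invr_ge0 exprn_ge0// ltW.
move=> k F; rewrite /pexp big_map /=.
under eq_bigr do rewrite -mulrA.
rewrite -big_distrr /=.
pose G j (i : 'I_n) := if j == k then rho j i * F i else rho j i.
rewrite (eq_bigr (fun f : {ffun 'I_K -> 'I_n} => \prod_j G j (f j))); last first.
  move=> f _; rewrite (bigD1 k)//= [RHS](bigD1 k)//= /G eqxx mulrAC.
  by congr (_ * _); apply: eq_bigr => j /negbTE ->.
rewrite -(bigA_distr_bigA G) (bigD1 k) //= [X in _ * (_ * X)](_ : _ = M ^+ K.-1).
  have ? : M ^+ K.-1 != 0 by rewrite expf_neq0 ?gt_eqF.
  rewrite mulrCA mulVf// mulr1 /G eqxx //.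
rewrite (eq_bigr (fun=> M)) => [|j jk]; last first.
  by rewrite -(rM j); apply: eq_bigr => i _; rewrite /G (negbTE jk).
rewrite prodr_const; congr (_ ^+ _).
have := cardC1 k; rewrite card_ord => <-.
by apply: eq_card => j; rewrite !inE.
Qed.

Lemma total_mass K (t : seq (R * ('I_K -> nat))) k :
  pexp t k (fun=> 1) = \sum_(p <- t) p.1.
Proof. by apply: eq_bigr => p _; rewrite mulr1. Qed.

(** One extraction multiplies the mass by [1 - th] with [th] independent of the
    step, so [m] extractions leave a mass of [(1 - th) ^+ m]. *)
Lemma joint_mixability (K n C : nat) (mu : 'I_K -> nat -> R) :
  (3 <= K)%N -> (n + K <= C)%N -> monotone_margins n C 1 mu ->
  exists th : R, 0 < th <= 1 /\ forall m : nat,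
  exists t t' : seq (R * ('I_K -> nat)),
    [/\ all (near_plane C) t, all (fun p => 0 <= p.1) t',
     \sum_(p <- t) p.1 = 1 - (1 - th) ^+ m &
     forall k F, pexp (t ++ t') k F = \sum_(i < n) mu k i * F i].
Proof.
move=> K3 nC muM.
(* [th = 1/B] satisfies both smallness conditions of [extract_block]. *)
pose B := ((2 * C + 1) * n ^ 2 + K * n ^ 3 + 2)%N.
pose th : R := B%:R^-1.
have B0 : 0 < B%:R :> R by rewrite ltr0n /B; lia.
have th0 : 0 < th by rewrite invr_gt0.
have thC : (2 * C + 1)%:R * n%:R ^+ 2 * th < 1.
  by rewrite ltr_pdivrMr// mul1r -natrX -natrM ltr_nat /B; lia.
have thK : K%:R * n%:R ^+ 3 * th < 1.
  by rewrite ltr_pdivrMr// mul1r -natrX -natrM ltr_nat /B; lia.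
have th1 : th < 1 by rewrite invf_lt1// ltr1n /B; lia.
exists th; split; first by rewrite th0 ltW.
have iter m : exists (t : seq (R * ('I_K -> nat))) (rho : 'I_K -> nat -> R),
    [/\ all (near_plane C) t, monotone_margins n C ((1 - th) ^+ m) rho &
    forall k F, pexp t k F + \sum_(i < n) rho k i * F i
              = \sum_(i < n) mu k i * F i].
  elim: m => [|m [t [rho [tg rM tE]]]].
    exists [::], mu; split=> // k F; by rewrite /pexp big_nil add0r.
  have Mm : 0 < (1 - th) ^+ m by rewrite exprn_gt0// subr_gt0.
  have [t' [rho' [tg' rM' tE']]] := extract_block K3 nC rM Mm th0 thC thK.
  exists (t ++ t'), rho'; split; first by rewrite all_cat tg.
    by rewrite exprS.
  by move=> k F; rewrite pexp_cat -addrA tE' tE.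
move=> m; have [t [rho [tg rM tE]]] := iter m.
have Mm : 0 < (1 - th) ^+ m by rewrite exprn_gt0// subr_gt0.
have [_ _ rs _] := rM.
have [t' [t'0 t'E]] := product_plan Mm (fun k i => monotone_margins_ge0 k i rM) rs.
exists t, t'; split=> //; last by move=> k F; rewrite pexp_cat t'E tE.
have K0 : (0 < K)%N by lia.
have s1 (f : nat -> R) : \sum_(i < n) f i * 1 = \sum_(i < n) f i.
  by apply: eq_bigr => i _; rewrite mulr1.
have := tE (Ordinal K0) (fun=> 1); rewrite total_mass !s1.
by rewrite rs; have [_ _ -> _] := muM => /(canRL (addrK _)).
Qed.
End iterate.

(** * Discretising decreasing densities *)

Section support.
Context {R : realFieldType} {K : nat}.

Lemma sum_all_ge0 (I : Type) (s : seq I) (P : pred I) (f : I -> R) :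
  all (fun p => 0 <= f p) s -> 0 <= \sum_(p <- s | P p) f p.
Proof.
elim: s => [|p s IH]; rewrite ?big_nil//= big_cons => /andP[p0 /IH s0].
by case: ifP => // _; exact: addr_ge0.
Qed.

Lemma sum_weights_eq0 (I : Type) (s : seq I) (f : I -> R) :
  all (fun p => 0 <= f p) s -> \sum_(p <- s) f p = 0 -> all (fun p => f p == 0) s.
Proof.
elim: s => //= p s IH /andP[p0 s0]; rewrite big_cons => /eqP.
by rewrite paddr_eq0 ?sum_all_ge0// => /andP[-> /eqP/(IH s0)].
Qed.

Lemma plan_support (s : seq (R * ('I_K -> nat))) k n (mu : nat -> R) :
  all (fun p => 0 <= p.1) s -> (forall i, 0 <= mu i) ->
  (forall F, pexp s k F = \sum_(i < n) mu i * F i) ->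
  all (fun p => (0 < p.1) ==> (p.2 k < n)%N && (0 < mu (p.2 k))) s.
Proof.
move=> s0 mu0 sE.
pose bad i := ~~ ((i < n)%N && (0 < mu i)).
have : pexp s k (fun i => (bad i)%:R) = 0.
  rewrite sE big1// => i _; rewrite /bad ltn_ord /= lt_neqAle mu0 andbT negbK.
  by case: eqP => [<-|_]; rewrite ?mul0r ?mulr0.
have nn : all (fun p : R * ('I_K -> nat) => 0 <= p.1 * (bad (p.2 k))%:R) s.
  by apply: sub_all s0 => p p0; rewrite mulr_ge0.
move=> /(sum_weights_eq0 nn); apply: sub_all => p /=.
rewrite mulf_eq0 => /orP[/eqP ->|]; first by rewrite ltxx.
by rewrite pnatr_eq0 eqb0 negbK => ->; rewrite implybT.
Qed.

Lemma sum_filter_pos (s : seq (R * ('I_K -> nat))) (f : R * ('I_K -> nat) -> R) :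
  all (fun p => 0 <= p.1) s ->
  \sum_(p <- s | 0 < p.1) p.1 * f p = \sum_(p <- s) p.1 * f p.
Proof.
elim: s => [|p s IH] /=; first by rewrite !big_nil.
move=> /andP[p0 /IH e]; rewrite !big_cons e lt_neqAle p0 andbT.
by case: eqP => //= <-; rewrite mul0r add0r.
Qed.
End support.

Lemma exists_small_power (R : realType) (q d : R) : 0 <= q < 1 -> 0 < d ->
  exists m : nat, q ^+ m <= d.
Proof.
move=> /andP[q0 q1] d0.
have /cvgr_lt : (GRing.exp q @ \oo --> (0 : R))%classic.
  by apply: cvg_expr; rewrite ger0_norm.
by move=> /(_ _ d0)[m _ h]; exists m; apply/ltW/h => /=.
Qed.

Section discretise.
Context {R : realType}.

(** The values of [X] in [[0, 1]] at which [w * X] crosses a multiple of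
    [1/N]; for [w = 0] the whole interval is in cell 0. *)
Definition grid_point (N : nat) (w : R) (i : nat) : R :=
  if w == 0 then (i != 0)%N%:R else Num.min 1 (i%:R / (N%:R * w)).

Lemma grid_pointP (N : nat) (w : R) : (0 < N)%N -> 0 <= w ->
  [/\ grid_point N w 0 = 0, (forall i, 0 <= grid_point N w i <= 1),
      (forall i, grid_point N w i <= grid_point N w i.+1),
      (forall i, grid_point N w i + grid_point N w i.+2 <= 2 * grid_point N w i.+1) &
      (forall i, N%:R * w * grid_point N w i <= i%:R /\
         (grid_point N w i < 1 -> N%:R * w * grid_point N w i = i%:R))].
Proof.
move=> N0 w0; rewrite /grid_point; have [->|wn0] := eqVneq w 0.
  split=> //=; first by move=> i; case: i => //=; rewrite ?lexx ler01.
  - by move=> i; case: i => //=; rewrite ?lexx ler01.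
  - by move=> i; case: i => //= [|i]; lra.
  - move=> i; split; first by rewrite mulr0 mul0r.
    by case: i => //= [|i]; rewrite ?mulr0 ?ltxx.
have Nw : 0 < N%:R * w by rewrite mulr_gt0 ?ltr0n// lt_neqAle eq_sym wn0.
set c := N%:R * w in Nw *.
have c0 : 0 <= c^-1 by rewrite invr_ge0 ltW.
split.
- by rewrite mul0r min_r.
- by move=> i; rewrite le_min ler01 divr_ge0//= ?ge_min ?lexx// ltW.
- move=> i; rewrite le_min !ge_min lexx /= orbC; apply/orP; left.
  by rewrite ler_wpM2r// ler_nat.
- move=> i; have -> : i.+2%:R / c = i%:R / c + (c^-1 + c^-1) by rewrite -!natr1; ring.
  have -> : i.+1%:R / c = i%:R / c + c^-1 by rewrite -natr1; ring.
  set a := i%:R / c; move: c0; set e := c^-1 => e0.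
  rewrite /Num.min; case: ifP => h1; case: ifP => h2; case: ifP => h3; lra.
- move=> i; split.
    rewrite -ler_pdivlMl// mulrC ge_min; apply/orP; right.
    by rewrite lexx.
  rewrite gt_min ltxx /= => h; rewrite min_r; last exact: ltW.
  by rewrite mulrC divfK ?gt_eqF.
Qed.

(** Here [g] is a concave distribution function on [[0, 1]], hence one with a
    decreasing density, [G] a primitive of it, and [m = 1 - (G 1 - G 0)] its
    mean.  If [X_k] has this law, [w k * X_k] is in cell [p.2 k] of the grid of
    step [1/N].  The hypothesis [w k <= m] makes the number [n] of cells smaller
    than the target sum, as [joint_mixability] requires.  The conclusion says
    that, outside a mass [d], the upper corner of the cell has sum at most
    [m + d] and the lower corner at least [m - d]. *)
Lemma discrete_mix (K : nat) (w : 'I_K -> R) (g G : R -> R) (m : R) :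
  (2 <= K)%N -> (forall k, 0 <= w k) -> \sum_k w k = 1 -> (forall k, w k <= m) ->
  g 0 = 0 -> g 1 = 1 ->
  (forall x y : R, 0 <= x -> x <= y -> y <= 1 -> g x <= g y) ->
  (forall x y : R, 0 <= x -> x <= y -> y <= 1 -> g x + g y <= 2 * g ((x + y) / 2)) ->
  (forall x y : R, 0 <= x -> x <= y -> y <= 1 ->
     (y - x) * g x <= G y - G x <= (y - x) * g y) ->
  m = 1 - (G 1 - G 0) ->
  forall d : R, 0 < d -> exists (N n : nat) (s : seq (R * ('I_K -> nat))),
  [/\ (0 < N)%N, (forall k, grid_point N (w k) n = 1), all (fun p => 0 < p.1) s,
   (forall k F, pexp s k F =
      \sum_(i < n) (g (grid_point N (w k) i.+1) - g (grid_point N (w k) i)) * F i) &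
   1 - d <= \sum_(p <- s | (\sum_k (p.2 k + 1)%:R <= N%:R * (m + d)) &&
                           (N%:R * (m - d) <= \sum_k (p.2 k)%:R)) p.1].
Proof.
move=> K2 w0 wS wm g0 g1 gle gcc Gb mE d d0.
have K0 : (0 < K)%N by lia.
have m0 : 0 < m.
  rewrite ltNge; apply/negP => m0.
  have : \sum_k w k <= 0 by apply: sumr_le0 => k _; apply: le_trans (wm k) m0.
  by rewrite wS ler10.
(* All rounding errors together are at most [E] cells, so [N] is chosen with
   [N * d] and [N * m] at least [E]. *)
pose E := (4 * K + 8)%N.
pose N := (Num.truncn (E%:R / d) + Num.truncn (E%:R / m)).+1.
have N0 : (0 < N)%N by [].
have NR0 : 0 < N%:R :> R by rewrite ltr0n.
have NE (a : R) : 0 < a -> (Num.truncn (E%:R / a) < N)%N -> E%:R <= N%:R * a.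
  move=> a0 h; have /andP[_] := truncn_itv (divr_ge0 (ler0n R E) (ltW a0)).
  rewrite ltr_pdivrMr// => /ltW h2; apply: le_trans h2 _.
  by apply: ler_wpM2r; [exact: ltW|rewrite ler_nat].
have NEd : E%:R <= N%:R * d by apply: NE => //; rewrite /N; lia.
have NEm : E%:R <= N%:R * m by apply: NE => //; rewrite /N; lia.
clear NE.
pose n := (Num.truncn (N%:R * m)).+1.
have /andP[n1 n2] := truncn_itv (mulr_ge0 (ltW NR0) (ltW m0)).
pose x k i := grid_point N (w k) i.
have xf k := grid_pointP N0 (w0 k).
have x0 k : x k 0%N = 0 by have [] := xf k.
have x01 k i : 0 <= x k i <= 1 by have [_ /(_ i)] := xf k.
have xle k i : x k i <= x k i.+1 by have [_ _ /(_ i)] := xf k.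
have xcc k i : x k i + x k i.+2 <= 2 * x k i.+1 by have [_ _ _ /(_ i)] := xf k.
have xup k i : N%:R * w k * x k i <= i%:R.
  by have [_ _ _ _ /(_ i)[]] := xf k.
have xeq k i : x k i < 1 -> N%:R * w k * x k i = i%:R.
  by have [_ _ _ _ /(_ i)[_]] := xf k.
have xn k i : (n <= i)%N -> x k i = 1.
  move=> ni; apply/eqP; rewrite eq_le; case/andP: (x01 k i) => _ -> /=.
  rewrite leNgt; apply/negP => xk1; have := xeq k i xk1.
  have : N%:R * w k * x k i <= N%:R * m.
    rewrite -mulrA ler_pM2l// -[leRHS]mulr1 ler_pM//; first by case/andP: (x01 k i).
    exact: ltW.
  have : n%:R <= i%:R :> R by rewrite ler_nat.
  by move: n2; rewrite -/n; lra.
pose q k i := g (x k i).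
pose mu k i := q k i.+1 - q k i.
have mu0 k i : 0 <= mu k i.
  rewrite subr_ge0; apply: gle => //; first by case/andP: (x01 k i).
  by case/andP: (x01 k i.+1).
have mudec k i : mu k i.+1 <= mu k i.
  rewrite /mu /q; have /andP[a0 a1] := x01 k i; have /andP[b0 b1] := x01 k i.+1.
  have /andP[c0 c1] := x01 k i.+2.
  have h1 := gcc _ _ a0 (le_trans (xle k i) (xle k i.+1)) c1.
  have h2 : g ((x k i + x k i.+2) / 2) <= g (x k i.+1).
    by apply: gle => //; have := xcc k i; lra.
  by lra.
have mun k i : (n <= i)%N -> mu k i = 0.
  by move=> ni; rewrite /mu /q !xn ?subrr// ltnW.
have mu1 k : \sum_(i < n) mu k i = 1.
  rewrite -(big_mkord predT (mu k)) telescope_sumr// /q xn// x0 g0 g1; ring.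
(* [Fi] is the primitive of [y] with respect to the law [g], up to a constant;
   it encloses the first moment of [mu k] between sums over cell ends. *)
pose Fi y := y * g y - G y.
have FiS k : \sum_(i < n) (Fi (x k i.+1) - Fi (x k i)) = m.
  rewrite -(big_mkord predT (fun i => Fi (x k i.+1) - Fi (x k i))).
  rewrite telescope_sumr// /Fi xn// x0 g1 mE; ring.
have Fib k i : x k i * mu k i <= Fi (x k i.+1) - Fi (x k i) <= x k i.+1 * mu k i.
  have /andP[a0 a1] := x01 k i; have /andP[b0 b1] := x01 k i.+1.
  have := Gb _ _ a0 (xle k i) b1; rewrite /Fi /mu /q => /andP[h1 h2].
  by apply/andP; split; lra.
have momlo k : \sum_(i < n) i%:R * mu k i <= N%:R * w k * m.
  rewrite -(FiS k) big_distrr /=; apply: ler_sum => i _.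
  have [x1|x1] := ltP (x k i) 1.
    rewrite -(xeq _ _ x1) -mulrA ler_wpM2l ?mulr_ge0//.
    by case/andP: (Fib k i).
  have xi : x k i = 1 by apply/eqP; rewrite eq_le x1; case/andP: (x01 k i) => _ ->.
  have xi1 : x k i.+1 = 1.
    apply/eqP; rewrite eq_le; case/andP: (x01 k i.+1) => _ -> /=.
    by rewrite -xi xle.
  by rewrite /mu /q xi xi1 !subrr !mulr0.
have momhi k : N%:R * w k * m <= \sum_(i < n) i.+1%:R * mu k i.
  rewrite -(FiS k) big_distrr /=; apply: ler_sum => i _.
  apply: (@le_trans _ _ (N%:R * w k * (x k i.+1 * mu k i))).
    by rewrite ler_wpM2l ?mulr_ge0//; case/andP: (Fib k i).
  by rewrite mulrA ler_wpM2r.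
pose S2 := \sum_k \sum_(i < n) (2 * i + 1)%:R * mu k i.
have S2E k : \sum_(i < n) (2 * i + 1)%:R * mu k i
   = 2 * (\sum_(i < n) i%:R * mu k i) + 1.
  rewrite -[X in _ = _ + X](mu1 k) big_distrr /= -big_split /=; apply: eq_bigr => i _.
  by rewrite (natrD _ (2 * i)) natrM; ring.
have S2E' k : \sum_(i < n) (2 * i + 1)%:R * mu k i
   = 2 * (\sum_(i < n) i.+1%:R * mu k i) - 1.
  rewrite -[X in _ = _ - X](mu1 k) big_distrr /= -sumrB /=; apply: eq_bigr => i _.
  by rewrite (natrD _ (2 * i)) natrM -natr1; ring.
have wE : N%:R * m = \sum_k N%:R * m * w k by rewrite -big_distrr /= wS mulr1.
have S2lo : 2 * (N%:R * m) - K%:R <= S2.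
  rewrite /S2; under eq_bigr do rewrite S2E'.
  rewrite sumrB sumr_const card_ord lerD2r -big_distrr /= ler_pM2l//.
  rewrite [leLHS]wE; apply: ler_sum => k _.
  by apply: le_trans (momhi k); rewrite mulrAC.
have S2hi : S2 <= 2 * (N%:R * m) + K%:R.
  rewrite /S2; under eq_bigr do rewrite S2E.
  rewrite big_split /= sumr_const card_ord lerD2r -big_distrr /= ler_pM2l//.
  rewrite [leRHS]wE; apply: ler_sum => k _.
  by apply: le_trans (momlo k) _; rewrite mulrAC.
have EE : E%:R = 4 * K%:R + 8 :> R by rewrite /E (natrD _ (4 * K)) natrM.
have KR : 2 <= K%:R :> R by rewrite ler_nat.
have S20 : 0 <= S2 / 2 by lra.
have /andP[] := truncn_itv S20.
set trS := Num.truncn (S2 / 2) => trS1 trS2.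
(* The sum [S2 / 2] of the means is not an integer in general, and [n + K <= C]
   may fail.  Both are repaired by one more coordinate, bounded by [n0], whose
   law is the mixture of the uniform laws on [n0] cells and on one cell with
   mean chosen such that the sum of all means is [C]. *)
pose C := (trS + 2 * K + 3)%N.
pose n0 := (4 * K + 6)%N.
have CE : C%:R = trS%:R + 2 * K%:R + 3 :> R.
  by rewrite /C (natrD _ (trS + 2 * K)) (natrD _ trS) natrM.
have n0E : n0%:R = 4 * K%:R + 6 :> R by rewrite /n0 (natrD _ (4 * K)) natrM.
pose lam := (2 * C%:R - S2 - 1) / (n0%:R - 1).
have trS2' : S2 / 2 < trS%:R + 1 by rewrite natr1.
have lam01 : 0 <= lam <= 1.
  rewrite /lam; apply/andP; split; first by rewrite divr_ge0; lra.
  by rewrite ler_pdivrMr; lra.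
have nE : n%:R <= N%:R * m + 1 by rewrite /n -natr1 lerD2r.
have n0n : (n0 <= n)%N.
  rewrite -(ler_nat R); move: n2; rewrite -/n; lra.
have nKC : (n + K.+1 <= C)%N.
  by rewrite -(ler_nat R) natrD -natr1; lra.
pose mu' (j : 'I_K.+1) i : R := if unlift ord0 j is Some k then mu k i else
   lam * unif 0 n0 i + (1 - lam) * unif 0 1 i.
have n00 : (0 < n0)%N by rewrite addn_gt0 orbT.
have n1' : (1 <= n)%N by [].
have /andP[lam0 lam1] := lam01.
have mm : monotone_margins n C 1 mu'.
  split.
  - move=> j i; rewrite /mu'; case: unliftP => [k _|_]; first exact: mudec.
    by rewrite lerD// ler_wpM2l ?subr_ge0 ?unif_nonincreasing.
  - move=> j i ni; rewrite /mu'; case: unliftP => [k _|_]; first exact: mun.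
    by rewrite !unif_out ?mulr0 ?addr0//; [exact: leq_trans ni|exact: leq_trans n0n ni].
  - move=> j; rewrite /mu'; case: unliftP => [k _|_]; first exact: mu1.
    have := @sum_unif R 0 n0 n (fun=> 1) n00 n0n.
    have := @sum_unif R 0 1 n (fun=> 1) isT n1'.
    rewrite !sumr_const_nat !subn0 invr1 mul1r mulVf ?pnatr_eq0 -?lt0n// => u1 u2.
    rewrite big_split /= -!big_distrr /=.
    rewrite (eq_bigr (fun i : 'I_n => unif 0 n0 i * 1)) => [|i _]; last by rewrite mulr1.
    rewrite u2 (eq_bigr (fun i : 'I_n => unif 0 1 i * 1)) => [|i _]; last by rewrite mulr1.
    by rewrite u1; ring.
  - rewrite big_ord_recl /mu' unlift_none.
    have -> : \sum_(i < K) \sum_(i0 < n) (2 * i0 + 1)%:R *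
      match unlift ord0 (lift ord0 i) with
      | Some k => mu k i0 | None => lam * unif 0 n0 i0 + (1 - lam) * unif 0 1 i0 end = S2.
      by apply: eq_bigr => k _; rewrite liftK.
    have := @sum_unif R 0 n0 n (fun i => (2 * i + 1)%:R) n00 n0n.
    have := @sum_unif R 0 1 n (fun i => (2 * i + 1)%:R) isT n1'.
    rewrite !sum_double_succ// !subn0 !subr0 => u1 u2.
    rewrite (eq_bigr (fun i : 'I_n => lam * (unif 0 n0 i * (2 * i + 1)%:R)
       + (1 - lam) * (unif 0 1 i * (2 * i + 1)%:R))) => [|i _]; last by ring.
    rewrite big_split /= -!big_distrr /= u1 u2 (natrM _ 2 C).
    have -> : n0%:R^-1 * (n0 ^ 2)%:R = n0%:R :> R.
      by rewrite (natrX _ n0 2) expr2 mulKf// pnatr_eq0 -lt0n.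
    have n01 : n0%:R - 1 != 0 :> R by rewrite gt_eqF//; lra.
    by rewrite invr1 mul1r /lam; field.
have K3 : (3 <= K.+1)%N by exact: K2.
have [th [th01 /= mix]] := joint_mixability K3 nKC mm.
have [|M Mle] := @exists_small_power _ (1 - th) d _ d0.
  by case/andP: th01 => th0 th1; rewrite subr_ge0 th1 gtrBl.
have [t [t' [tg t'0 tS tE]]] := mix M.
have t0 : all (fun p => 0 <= p.1) t by apply: sub_all tg => p /andP[].
have tt0 : all (fun p => 0 <= p.1) (t ++ t') by rewrite all_cat t0.
pose proj (p : R * ('I_K.+1 -> nat)) := (p.1, fun k : 'I_K => p.2 (lift ord0 k)).
exists N, n, [seq proj p | p <- t ++ t' & 0 < p.1]; split => //.
- by move=> k; exact: xn.
- by rewrite all_map; exact: filter_all.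
- move=> k F; rewrite /pexp big_map big_filter /=.
  rewrite (@sum_filter_pos _ _ _ (fun p => F (p.2 (lift ord0 k))))//.
  by have := tE (lift ord0 k) F; rewrite /pexp => ->; rewrite /mu' liftK.
(* The additional coordinate is less than [n0] at all points of positive weight,
   so forgetting it moves the sum by at most [n0] cells. *)
have sup0 : all (fun p => (0 < p.1) ==> (p.2 ord0 < n0)%N) (t ++ t').
  have h := @plan_support _ _ (t ++ t') ord0 n (mu' ord0) tt0 _ (tE ord0).
  apply: sub_all (h _) => [p|i].
    case: (0 < p.1) => //= /andP[_]; rewrite /mu' unlift_none ltnNge => h0.
    apply/negP => h1; move: h0; rewrite !unif_out ?mulr0 ?addr0 ?ltxx//.
    by apply: leq_trans h1.
  rewrite /mu' unlift_none /unif.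
  by apply: addr_ge0; apply: mulr_ge0; rewrite ?subr_ge0//; case: ifP => // _; rewrite invr_ge0.
rewrite big_map big_filter_cond /=.
apply: (@le_trans _ _ (\sum_(p <- t) p.1)); first by rewrite tS lerD2l lerN2.
rewrite big_cat /= ler_wpDr ?sum_all_ge0//.
have : all (fun p => (0 < p.1) ==> (p.2 ord0 < n0)%N) t.
  by move: sup0; rewrite all_cat => /andP[].
elim: t tg {t' t'0 tS tE t0 tt0 sup0} => [|p t IH] /=; first by rewrite !big_nil.
move=> /andP[/andP[p0 /andP[plo phi]] tg] /andP[ps ts]; rewrite !big_cons.
have IH' := IH tg ts.
have [p00|pp] := leP p.1 0.
  have -> : p.1 = 0 by apply/eqP; rewrite eq_le p00.
  by rewrite add0r.
have {}ps : (p.2 ord0 < n0)%N by move: ps; rewrite pp.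
rewrite big_ord_recl in plo phi; set X := (\sum_(i < K) _)%N in plo phi.
have XE : \sum_k (p.2 (lift ord0 k))%:R = X%:R :> R by rewrite natr_sum.
have XE1 : \sum_k (p.2 (lift ord0 k) + 1)%:R = X%:R + K%:R :> R.
  rewrite -XE -[X in _ + X%:R]card_ord -sumr_const -big_split /=.
  by apply: eq_bigr => k _; rewrite natrD.
rewrite XE XE1.
have plo' : C%:R <= n0%:R + X%:R + (K%:R + 1 + 3) :> R.
  have : (C <= n0 + X + (K.+1 + 3))%N.
    by apply: (leq_trans plo); rewrite leq_add2r leq_add2r; exact: ltnW.
  by rewrite -(ler_nat R) (natrD _ (n0 + X)) (natrD _ n0) (natrD _ K.+1) -[K.+1%:R]natr1.
have phi' : X%:R <= C%:R :> R.
  rewrite ler_nat; apply: leq_trans (leq_addl (p.2 ord0) X) _.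
  by move: phi; rewrite leq_add2r.
have -> : X%:R + K%:R <= N%:R * (m + d) by lra.
have -> : N%:R * (m - d) <= X%:R by lra.
by rewrite /= lerD2l.
Qed.

End discretise.

(** * Mixtures of boxes for powers of uniform variables *)

Section power.
Context {R : realType}.

Lemma ge0_powR_le (p x y : R) : 0 <= p -> 0 <= x -> x <= y -> x `^ p <= y `^ p.
Proof. by move=> p0 x0 xy; apply: ge0_ler_powR; rewrite ?nnegrE// (le_trans x0). Qed.

Lemma powR_monotone_integral (p a b : R) : 0 < p -> 0 <= a -> a <= b ->
  (b - a) * a `^ p <= b `^ (p + 1) / (p + 1) - a `^ (p + 1) / (p + 1)
    <= (b - a) * b `^ p.
Proof.
move=> p0 a0; have p1 : p + 1 != 0 by rewrite gt_eqF// addr_gt0.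
have mulp (x : R) : 0 <= x -> x `^ (p + 1) = x * x `^ p.
  by move=> x0; rewrite -(mulr_powRB1 x0 (addr_gt0 p0 ltr01)) addrK.
rewrite le_eqVlt => /predU1P[<-|ab]; first by rewrite !subrr !mul0r lexx.
have b0 : 0 <= b by rewrite (le_trans a0) ?ltW.
move: a0 ab; rewrite le_eqVlt => /predU1P[<- _|a0 ab].
  rewrite !powR0 ?gt_eqF ?addr_gt0// mulr0 mul0r !subr0 mulp//.
  rewrite divr_ge0 ?mulr_ge0 ?powR_ge0//=; last lra.
  rewrite ler_pdivrMr; last lra.
  by rewrite ler_peMr ?mulr_ge0 ?powR_ge0//; lra.
have dF x : x \in `]a, b[ -> is_derive x 1 (fun x : R => x `^ (p + 1)) ((p + 1) * x `^ p).
  rewrite in_itv /= => /andP[ax _].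
  by have := is_derive1_powR (p + 1) (lt_trans a0 ax); rewrite addrK.
have cF : {within `[a, b], continuous (fun x : R => x `^ (p + 1))}%classic.
  apply: derivable_within_continuous => x; rewrite in_itv /= => /andP[ax _].
  by apply: derivable_powR; rewrite in_itv /= andbT; exact: lt_le_trans ax.
have [c] := MVT ab dF cF; rewrite in_itv /= => /andP[ac cb].
have -> : b `^ (p + 1) / (p + 1) - a `^ (p + 1) / (p + 1)
   = (b `^ (p + 1) - a `^ (p + 1)) / (p + 1) by field.
move=> ->; have -> : (p + 1) * c `^ p * (b - a) / (p + 1) = (b - a) * c `^ p by field.
have c0 : 0 < c by exact: lt_trans ac.
have ba : 0 <= b - a by rewrite subr_ge0 ltW.
by apply/andP; split; apply: ler_wpM2l => //; apply: ge0_powR_le; exact: ltW.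
Qed.

Lemma powR_midpoint_convex (p x y : R) : 1 <= p -> 0 <= x -> 0 <= y ->
  ((x + y) / 2) `^ p <= (x `^ p + y `^ p) / 2.
Proof.
move=> p1 x0 y0.
have h0 : 0 <= 2^-1 :> R by lra.
have h1 : 2^-1 <= 1 :> R by lra.
have := @convex_powR R p p1 (Itv01 h0 h1) x y.
rewrite !inE /= !in_itv /= !andbT => /(_ x0 y0).
rewrite convRE [X in X `^ _ <= _ -> _]convRE /=.
have e (a b : R) : 2^-1 * a + (1 - 2^-1) * b = (a + b) / 2 by field.
by rewrite /unstable.onem !e.
Qed.

(** The distribution function of the uniform law on [[lo, hi]]. *)
Definition ramp (lo hi y : R) : R := Num.max 0 (Num.min 1 ((y - lo) / (hi - lo))).

Lemma ramp_len (lo hi y : R) : lo <= hi ->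
  (hi - lo) * ramp lo hi y = Num.min y hi - Num.min y lo.
Proof.
rewrite le_eqVlt => /predU1P[->|lh]; first by rewrite !subrr mul0r.
have d0 : 0 < hi - lo by rewrite subr_gt0.
rewrite /ramp; have [yl|yl] := leP y lo.
  have h : (y - lo) / (hi - lo) <= 0 by rewrite ler_pdivrMr// mul0r subr_le0.
  rewrite max_l ?ge_min ?h ?orbT// mulr0 min_l ?subrr//.
  by rewrite (le_trans yl) ?ltW.
have h : 0 <= (y - lo) / (hi - lo) by rewrite divr_ge0 ?ltW ?subr_gt0.
rewrite max_r ?le_min ?ler01//.
have [yh|yh] := leP y hi.
  rewrite min_r; first by rewrite mulrC divfK// gt_eqF.
  by rewrite ler_pdivrMr// mul1r lerD2r.
rewrite min_l ?mulr1// ler_pdivlMr// mul1r lerD2r; exact: ltW.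
Qed.

Lemma le_sum_filter (I : Type) (s : seq I) (f : I -> R) (P Q A : pred I) :
  all A s -> (forall p, A p -> 0 <= f p) -> (forall p, A p -> P p -> Q p) ->
  \sum_(p <- s | P p) f p <= \sum_(p <- s | Q p) f p.
Proof.
move=> sA f0 PQ; elim: s sA => [|p s IH] /=; first by rewrite !big_nil.
move=> /andP[pA /IH h]; rewrite !big_cons.
case: ifP => Pp; first by rewrite (PQ _ pA Pp) lerD2l.
by case: ifP => // _; rewrite ler_wpDl ?f0.
Qed.

Lemma all_both (I : Type) (s : seq I) (P Q : pred I) :
  all P s -> all Q s -> all (fun p => P p && Q p) s.
Proof. by elim: s => //= p s IH /andP[-> /IH h] /andP[-> /h]. Qed.

Lemma all_forall (I : Type) (J : finType) (s : seq I) (P : J -> pred I) :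
  (forall j, all (P j) s) -> all (fun p => [forall j, P j p]) s.
Proof.
elim: s => //= p s IH h; apply/andP; split.
  by apply/forallP => j; case/andP: (h j).
by apply: IH => j; case/andP: (h j).
Qed.

Definition proper_boxes (K : nat) (s : seq (R * ('I_K -> R * R))) :=
  all (fun p => (0 < p.1) &&
    [forall k, (0 <= (p.2 k).1) && ((p.2 k).1 < (p.2 k).2) && ((p.2 k).2 <= 1)]) s.

(** The mixture, with the weights [p.1], of the laws whose [k]-th coordinate is
    uniform between the two entries of [p.2 k] has margins uniform on [[0, 1]]. *)
Definition uniform_boxes (K : nat) (s : seq (R * ('I_K -> R * R))) :=
  [/\ proper_boxes s, \sum_(p <- s) p.1 = 1 &
      forall k y, 0 <= y <= 1 -> \sum_(p <- s) p.1 * ramp (p.2 k).1 (p.2 k).2 y = y].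

Definition cell_boxes (K : nat) (lo hi : 'I_K -> nat -> R) (s : seq (R * ('I_K -> nat)))
  : seq (R * ('I_K -> R * R)) :=
  [seq (p.1, fun k => (lo k (p.2 k), hi k (p.2 k))) | p <- s].

Lemma cell_boxes_margins (K n : nat) (lo hi : 'I_K -> nat -> R)
    (s : seq (R * ('I_K -> nat))) :
  (forall k i, lo k i <= hi k i) ->
  (forall k F, pexp s k F = \sum_(i < n) (hi k i - lo k i) * F i) ->
  (forall k y, 0 <= y <= 1 ->
     \sum_(i < n) (Num.min y (hi k i) - Num.min y (lo k i)) = y) ->
  forall k y, 0 <= y <= 1 ->
  \sum_(p <- cell_boxes lo hi s) p.1 * ramp (p.2 k).1 (p.2 k).2 y = y.
Proof.
move=> lh sE tel k y y01; rewrite big_map /=.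
rewrite -[RHS](tel k y y01) -[LHS]/(pexp s k (fun i => ramp (lo k i) (hi k i) y)) sE.
by apply: eq_bigr => i _; rewrite ramp_len.
Qed.

(** The [k]-th margin of [s] gives to each cell its length and the cells fill
    [[0, 1]], so replacing integers by cells yields uniform margins.  Points of
    positive weight only use cells of positive length. *)
Lemma cell_boxes_spec (K n : nat) (w : 'I_K -> R) (lo hi : 'I_K -> nat -> R)
    (s : seq (R * ('I_K -> nat))) (r c d : R) (good : pred (R * ('I_K -> nat))) :
  (0 < K)%N -> all (fun p => 0 < p.1) s ->
  (forall k i, (0 <= lo k i) && (lo k i <= hi k i) && (hi k i <= 1)) ->
  (forall k F, pexp s k F = \sum_(i < n) (hi k i - lo k i) * F i) ->
  (forall k y, 0 <= y <= 1 ->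
     \sum_(i < n) (Num.min y (hi k i) - Num.min y (lo k i)) = y) ->
  1 - d <= \sum_(p <- s | good p) p.1 ->
  (forall p, (forall k, lo k (p.2 k) < hi k (p.2 k)) -> good p ->
     \sum_k w k * hi k (p.2 k) `^ r <= c + d) ->
  exists s : seq (R * ('I_K -> R * R)),
  uniform_boxes s /\
  1 - d <= \sum_(p <- s | \sum_k w k * (p.2 k).2 `^ r <= c + d) p.1.
Proof.
move=> K0 s0 lh sE tel sgood hgood.
have s0' : all (fun p : R * ('I_K -> nat) => 0 <= p.1) s.
  by apply: sub_all s0 => p /ltW.
have lo_hi k i : lo k i <= hi k i by case/andP: (lh k i) => /andP[].
have sup : all (fun p => [forall k, lo k (p.2 k) < hi k (p.2 k)]) s.
  apply: all_forall => k.
  have h := @plan_support _ _ s k n (fun i => hi k i - lo k i) s0' _ (sE k).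
  have {}h := h (fun i => eq_ind_r is_true (lo_hi k i) (subr_ge0 _ _)).
  by apply: sub_all (all_both s0 h) => p /andP[-> /= /andP[_]]; rewrite subr_gt0.
have tot : \sum_(p <- s) p.1 = 1.
  have y01 : 0 <= (1 : R) <= 1 by rewrite ler01 lexx.
  have := tel (Ordinal K0) 1 y01.
  rewrite -(total_mass s (Ordinal K0)) sE => h; rewrite -[RHS]h; apply: eq_bigr => i _.
  have /andP[/andP[l0 lhi] h1] := lh (Ordinal K0) i.
  by rewrite mulr1 !min_r// (le_trans lhi).
exists (cell_boxes lo hi s); split; first split.
- rewrite /proper_boxes all_map; apply: sub_all (all_both s0 sup) => p /= /andP[-> /forallP h] /=.
  apply/forallP => k; rewrite h andbT.
  by case/andP: (lh k (p.2 k)) => /andP[-> _ ->].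
- by rewrite big_map.
- exact: (@cell_boxes_margins _ n).
- apply: le_trans sgood _; rewrite big_map /=.
  apply: (le_sum_filter (all_both s0 sup)) => [p /andP[/ltW]//|p /andP[_ /forallP h]].
  exact: hgood.
Qed.

(** For [1 <= r] the variable [U^r] has the concave distribution function
    [x^(1/r)] and mean [1/(r+1)], and the upper corners of [discrete_mix] bound
    [\sum_k w k * U_k^r].  For [r < 1] the same is done for [1 - U^r], with
    concave distribution function [1 - (1-x)^(1/r)] and mean [r/(r+1)]; the
    order is reversed, so the lower corners count. *)
Lemma mean_power_boxes (K : nat) (w : 'I_K -> R) (r d : R) :
  (2 <= K)%N -> (forall k, 0 <= w k) -> \sum_k w k = 1 -> 0 < r ->
  (forall k, w k * (r + 1) <= 1) -> (forall k, w k * (r + 1) <= r) -> 0 < d ->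
  exists s : seq (R * ('I_K -> R * R)),
  uniform_boxes s /\
  1 - d <= \sum_(p <- s | \sum_k w k * (p.2 k).2 `^ r <= (r + 1)^-1 + d) p.1.
Proof.
move=> K2 w0 wS r0 wm1 wm2 d0.
have K0 : (0 < K)%N by apply: leq_trans K2.
have rr0 : 0 < r + 1 by lra.
pose a := r^-1; have a0 : 0 < a by rewrite invr_gt0.
have ra : r * a = 1 by rewrite mulfV// gt_eqF.
have ar : a * r = 1 by rewrite mulrC.
have a10 : 0 < a + 1 by lra.
have [r1|r1] := leP 1 r.
- pose g (x : R) := x `^ a.
  pose G (x : R) := x `^ (a + 1) / (a + 1).
  have gr x : 0 <= x -> g x `^ r = x by move=> x0; rewrite /g -powRrM ar powRr1.
  have g_le (x y : R) : 0 <= x -> x <= y -> g x <= g y.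
    by apply: ge0_powR_le; exact: ltW.
  have g0 : g 0 = 0 by rewrite /g powR0// gt_eqF.
  have g1 : g 1 = 1 by rewrite /g powR1.
  have [//|||||N [n [s [N0 xn s0 sE sg]]]] :=
    @discrete_mix R K w g G (r + 1)^-1 K2 w0 wS _ g0 g1 _ _ _ _ d d0.
  + by move=> k; rewrite -div1r ler_pdivlMr.
  + by move=> x y x0 xy _; exact: g_le.
  + move=> x y x0 xy _; have y0 := le_trans x0 xy.
    have h := powR_midpoint_convex r1 (powR_ge0 x a) (powR_ge0 y a).
    rewrite -/(g x) -/(g y) !gr// in h.
    have := g_le _ _ (powR_ge0 _ _) h.
    rewrite {1}/g -powRrM ra powRr1; first by lra.
    by rewrite divr_ge0// addr_ge0 ?powR_ge0.
  + by move=> x y x0 xy _; exact: powR_monotone_integral.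
  + rewrite /G powR1 powR0 ?gt_eqF// mul0r subr0 /a; field.
    by rewrite !gt_eqF//; lra.
  pose q k i := g (grid_point N (w k) i).
  have xf k := grid_pointP N0 (w0 k).
  have x01 k i : 0 <= grid_point N (w k) i <= 1 by have [_ /(_ i)] := xf k.
  have xle k i : grid_point N (w k) i <= grid_point N (w k) i.+1 by have [_ _ /(_ i)] := xf k.
  apply: (@cell_boxes_spec K n w q (fun k i => q k i.+1) s r _ d _ K0 s0 _ sE _ sg).
  + move=> k i; rewrite /q -g1 powR_ge0/=; apply/andP; split; apply: g_le => //.
      by case/andP: (x01 k i).
    by case/andP: (x01 k i.+1).
    by case/andP: (x01 k i.+1).
  + move=> k y /andP[y0 y1].
    rewrite -(big_mkord predT (fun i => Num.min y (q k i.+1) - Num.min y (q k i))).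
    rewrite telescope_sumr// /q xn g1; have [-> _ _ _ _] := xf k.
    by rewrite g0 (min_l y1) (min_r y0) subr0.
  + move=> p _ /andP[h _]; rewrite -(@ler_pM2l _ N%:R) ?ltr0n//.
    apply: le_trans h; rewrite big_distrr /=; apply: ler_sum => k _.
    rewrite /q gr; last by case/andP: (x01 k (p.2 k).+1).
    by rewrite mulrA addn1; have [_ _ _ _ /(_ (p.2 k).+1)[]] := xf k.
- have a1 : 1 <= a by rewrite /a invf_ge1// ltW.
  pose g (x : R) := 1 - (1 - x) `^ a.
  pose G (x : R) := x + (1 - x) `^ (a + 1) / (a + 1).
  have g_le (x y : R) : x <= y -> y <= 1 -> g x <= g y.
    move=> xy y1; rewrite lerD2l lerN2; apply: ge0_powR_le; lra.
  have g0 : g 0 = 0 by rewrite /g subr0 powR1 subrr.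
  have g1 : g 1 = 1 by rewrite /g subrr powR0 ?subr0// gt_eqF.
  have [//|||||N [n [s [N0 xn s0 sE sg]]]] :=
    @discrete_mix R K w g G (r / (r + 1)) K2 w0 wS _ g0 g1 _ _ _ _ d d0.
  + by move=> k; rewrite ler_pdivlMr.
  + by move=> x y x0 xy y1; exact: g_le.
  + move=> x y x0 xy y1; rewrite /g.
    have h := @powR_midpoint_convex a (1 - x) (1 - y) a1.
    have {}h := h (eq_ind_r is_true (le_trans xy y1) (subr_ge0 _ _))
       (eq_ind_r is_true y1 (subr_ge0 _ _)).
    have e : 1 - (x + y) / 2 = (1 - x + (1 - y)) / 2 by field.
    by rewrite e; lra.
  + move=> x y x0 xy y1.
    have := @powR_monotone_integral a (1 - y) (1 - x) a0.
    rewrite subr_ge0 lerD2l lerN2 => /(_ y1 xy); rewrite /g /G => /andP[h1 h2].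
    by apply/andP; split; lra.
  + rewrite /G subrr subr0 powR1 powR0 ?gt_eqF// /a; field.
    by rewrite !gt_eqF//; lra.
  pose q k i := g (grid_point N (w k) i).
  have xf k := grid_pointP N0 (w0 k).
  have x01 k i : 0 <= grid_point N (w k) i <= 1 by have [_ /(_ i)] := xf k.
  have xle k i : grid_point N (w k) i <= grid_point N (w k) i.+1 by have [_ _ /(_ i)] := xf k.
  have xeq k i : grid_point N (w k) i < 1 -> N%:R * w k * grid_point N (w k) i = i%:R.
    by have [_ _ _ _ /(_ i)[_]] := xf k.
  apply: (@cell_boxes_spec K n w (fun k i => 1 - q k i.+1) (fun k i => 1 - q k i)
    s r _ d _ K0 s0 _ _ _ sg).
  + move=> k i; have /andP[u1 u2] := x01 k i; have /andP[v1 v2] := x01 k i.+1.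
    rewrite subr_ge0 -{1}g1 g_le//= lerD2l lerN2 g_le//= gerBl -g0 g_le//.
  + move=> k F; rewrite sE; apply: eq_bigr => i _; rewrite /q; congr (_ * _); ring.
  + move=> k y /andP[y0 y1].
    pose h i := - Num.min y (1 - q k i).
    rewrite (eq_bigr (fun i : 'I_n => h i.+1 - h i)) => [|i _]; last by rewrite /h opprK addrC.
    rewrite -(big_mkord predT (fun i => h i.+1 - h i)).
    rewrite telescope_sumr// /h /q xn g1; have [-> _ _ _ _] := xf k.
    by rewrite g0 subrr subr0 (min_l y1) (min_r y0) oppr0 add0r opprK.
  + move=> p ph /andP[_ h].
    have px k : grid_point N (w k) (p.2 k) < 1.
      rewrite lt_neqAle; case/andP: (x01 k (p.2 k)) => _ -> ; rewrite andbT.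
      apply/eqP => x1; have := ph k; rewrite ltrD2l ltrN2 /q x1.
      rewrite ltNge g_le//; by case/andP: (x01 k (p.2 k).+1).
    have e : \sum_k w k * (1 - q k (p.2 k)) `^ r = 1 - \sum_k w k * grid_point N (w k) (p.2 k).
      transitivity (\sum_k w k - \sum_k w k * grid_point N (w k) (p.2 k)); last by rewrite wS.
      rewrite -sumrB; apply: eq_bigr => k _.
      rewrite /q /g [1 - (1 - _)](_ : _ = (1 - grid_point N (w k) (p.2 k)) `^ a); last by ring.
      by rewrite -powRrM ar powRr1 ?subr_ge0 ?ltW//; ring.
    rewrite e -(@ler_pM2l _ N%:R) ?ltr0n//.
    have e2 : N%:R * \sum_k w k * grid_point N (w k) (p.2 k) = \sum_k (p.2 k)%:R.
      by rewrite big_distrr; apply: eq_bigr => k _; rewrite /= mulrA xeq.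
    rewrite mulrBr mulr1 e2.
    have e3 : (r + 1)^-1 = 1 - r / (r + 1) by field; rewrite gt_eqF.
    by rewrite e3; lra.
Qed.

End power.

(** * A uniform variable on an atomless space *)

Section pr.
Context {R : realType} {d : measure_display} {T : measurableType d}.
Context (P : probability T R).

Definition pr (A : set T) : R := fine (P A).

Lemma prE A : measurable A -> P A = (pr A)%:E.
Proof. by move=> mA; rewrite /pr fineK// fin_num_measure. Qed.

Lemma pr_ge0 A : 0 <= pr A.
Proof. exact: fine_ge0. Qed.

Lemma pr_le A B : measurable A -> measurable B -> A `<=` B -> pr A <= pr B.
Proof.
by move=> mA mB AB; rewrite -lee_fin -!prE// le_measure// inE.
Qed.

Lemma pr_set0 : pr set0 = 0. Proof. by rewrite /pr measure0. Qed.

Lemma pr_setT : pr setT = 1. Proof. by rewrite /pr probability_setT. Qed.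

Lemma prU A B : measurable A -> measurable B -> A `&` B = set0 ->
  pr (A `|` B) = pr A + pr B.
Proof.
move=> mA mB AB; apply: EFin_inj.
by rewrite EFinD -!prE ?measureU//; exact: measurableU.
Qed.

Lemma prD A B : measurable A -> measurable B -> B `<=` A ->
  pr (A `\` B) = pr A - pr B.
Proof.
move=> mA mB BA; rewrite -{2}(setDUK BA) prU//; first by ring.
  exact: measurableD.
exact: setDIK.
Qed.

Lemma sup_approx (S : set R) : S !=set0 -> has_ubound S -> (forall x, S x -> 0 <= x) ->
  exists2 x, S x & forall y, S y -> y <= 2 * x.
Proof.
move=> S0 Sub Sge.
have [s0|s0] := leP (sup S) 0.
  have [x Sx] := S0; exists x => // y Sy.
  have : y <= sup S by exact: ub_le_sup.
  by have := Sge _ Sx; lra.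
have hs : has_sup S by [].
have [x Sx xs] := @sup_adherent _ S (sup S / 2) (divr_gt0 s0 (ltr0Sn R 1)) hs.
exists x => // y Sy; have : y <= sup S by exact: ub_le_sup.
by lra.
Qed.

Context (hP : atomless P).

(** By atomlessness a set of positive probability has a subset of positive
    probability at most half of it: a proper piece or its complement. *)
Lemma small_piece A e : measurable A -> 0 < pr A -> 0 < e ->
  exists B, [/\ measurable B, B `<=` A, 0 < pr B & pr B <= e].
Proof.
move=> mA A0 e0.
have halve B : measurable B -> 0 < pr B ->
    exists C, [/\ measurable C, C `<=` B, 0 < pr C & pr C <= pr B / 2].
  move=> mB B0; have : (0 < P B)%E by rewrite prE// lte_fin.
  move=> /(hP mB)[C [mC CB]]; rewrite !prE// !lte_fin => C0 CltB.
  have [h|h] := leP (pr C) (pr B / 2); first by exists C.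
  exists (B `\` C); rewrite prD//; split => //; try lra.
  - exact: measurableD.
have iter n : exists C, [/\ measurable C, C `<=` A, 0 < pr C & pr C <= 2^-1 ^+ n].
  elim: n => [|n [C [mC CA C0 Cn]]].
    exists A; split => //; rewrite expr0 -pr_setT; exact: pr_le.
  have [D [mD DC D0 Dn]] := halve C mC C0.
  exists D; split => //; first exact: subset_trans CA.
  by rewrite exprSr; lra.
have [|m h] := @exists_small_power R 2^-1 e _ e0; first by apply/andP; split; lra.
have [C [mC CA C0 Cn]] := iter m.
by exists C; split => //; exact: le_trans h.
Qed.

(** Sierpinski's theorem.  [Bn] grows greedily: each step adds a set whose
    probability is at least half of the largest possible one that stays below
    [c].  If the union had probability less than [c], a [small_piece] of the
    rest would have been available at every step, so every step would have added
    at least a fixed amount. *)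
Lemma sierpinski A (c : R) : measurable A -> 0 <= c <= pr A ->
  exists B, [/\ measurable B, B `<=` A & pr B = c].
Proof.
move=> mA /andP[c0 cA].
pose good B := [/\ measurable B, B `<=` A & pr B <= c].
have next B : exists B', good B -> [/\ good B', B `<=` B' &
    forall D, measurable D -> D `<=` A `\` B -> pr B + pr D <= c ->
      pr D <= 2 * (pr B' - pr B)].
  have [[mB BA Bc]|nB] := pselect (good B); last by exists B.
  pose S := [set x | exists C,
    [/\ measurable C, C `<=` A `\` B, pr B + pr C <= c & x = pr C]].
  have [| | |x [C [mC CAB BCc ->]] h] := @sup_approx S.
  - exists 0, set0; split => //; last by rewrite pr_set0.
    by rewrite pr_set0 addr0.
  - exists c => x [C [mC _ h ->]]; by have := pr_ge0 B; lra.
  - by move=> x [C [_ _ _ ->]]; exact: pr_ge0.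
  have BC0 : B `&` C = set0.
    by apply/seteqP; split => // t [Bt /CAB[]].
  exists (B `|` C) => _; split; rewrite ?prU//.
  - split; rewrite ?prU//; first exact: measurableU.
    by rewrite subUset; split => // t /CAB[].
  - move=> D mD DAB hD; rewrite addrAC subrr add0r; apply: h.
    by exists D.
have /choice[f hf] := next.
pose Bn n := iter n f set0.
have gB n : good (Bn n).
  elim: n => [|n IH].
    by split; [exact: measurable0|exact: sub0set|rewrite pr_set0].
  by have [] := hf _ IH.
have ndB : nondecreasing_seq Bn.
  by apply/nondecreasing_seqP => n; apply/subsetPset; have [] := hf _ (gB n).
have mB n : measurable (Bn n) by case: (gB n).
pose Bw := \bigcup_n Bn n.
have mBw : measurable Bw by exact: bigcup_measurable.
have BwA : Bw `<=` A by move=> t [n _]; case: (gB n) => _ + _; exact.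
have Bwc : pr Bw <= c.
  rewrite -lee_fin -prE//.
  have cv : (P \o Bn) @ \oo --> P Bw by exact: nondecreasing_cvg_mu mB mBw ndB.
  rewrite -(cvg_lim _ cv)//; apply: lime_le; first by apply/cvg_ex; exists (P Bw).
  by apply: nearW => n; rewrite /= prE// lee_fin; case: (gB n).
exists Bw; split => //; apply/eqP; rewrite eq_le Bwc /= leNgt; apply/negP => ltc.
have AB0 : 0 < pr (A `\` Bw) by rewrite prD//; lra.
have cB : 0 < c - pr Bw by rewrite subr_gt0.
have [D [mD DAB D0 Dc]] := small_piece (measurableD mA mBw) AB0 cB.
have inc n : pr D <= 2 * (pr (Bn n.+1) - pr (Bn n)).
  have [_ _ h] := hf _ (gB n); apply: h => //.
    by move=> t /DAB[At nB]; split => // Bt; apply: nB; exists n.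
  have : pr (Bn n) <= pr Bw by apply: pr_le => // t; exists n.
  by lra.
have lin n : n%:R * pr D <= 2 * pr (Bn n).
  elim: n => [|n IH]; first by rewrite mul0r mulr_ge0// pr_ge0.
  by rewrite -natr1 mulrDl mul1r; have := inc n; lra.
have [n hn] : exists n : nat, 2 * c < n%:R * pr D.
  exists (Num.truncn (2 * c / pr D)).+1.
  rewrite -ltr_pdivrMr//; 
  have /andP[_] := truncn_itv (divr_ge0 (mulr_ge0 (ler0n R 2) c0) (ltW D0)).
  exact.
have := lin n; case: (gB n) => _ _; lra.
Qed.

Definition nat_measurable (Z : T -> nat) := forall i, measurable [set t | Z t = i].

Lemma nat_measurable_fun (Z : T -> nat) (h : nat -> R) : nat_measurable Z ->
  measurable_fun setT (h \o Z).
Proof.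
move=> mZ _ Y mY; rewrite setTI.
rewrite [X in measurable X](_ : _ = \bigcup_(i in [set i | Y (h i)]) [set t | Z t = i]).
  by apply: bigcup_measurable => i _; exact: mZ.
apply/seteqP; split => [t Yt|t [i Yi /= e]]; first by exists (Z t).
by rewrite /= e.
Qed.

(** Splitting every level set of [Z] into halves appends one binary digit. *)
Lemma split_level (Z : T -> nat) : nat_measurable Z ->
  exists Z' : T -> nat, [/\ nat_measurable Z',
    (forall t, 2 * Z t <= Z' t <= 2 * Z t + 1)%N &
    forall i (b : bool), pr [set t | Z' t = 2 * i + b]%N = pr [set t | Z t = i] / 2].
Proof.
move=> mZ.
have half i : exists B, [/\ measurable B, B `<=` [set t | Z t = i] &
    pr B = pr [set t | Z t = i] / 2].
  apply: sierpinski; first exact: mZ.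
  by have := pr_ge0 [set t | Z t = i]; move=> ?; apply/andP; split; lra.
have /choice[B hB] := half.
have mB i : measurable (B i) by case: (hB i).
have sB i : B i `<=` [set t | Z t = i] by case: (hB i).
have pB i : pr (B i) = pr [set t | Z t = i] / 2 by case: (hB i).
pose Z' t := (2 * Z t + `[< B (Z t) t >])%N.
have Z'1 i : [set t | Z' t = 2 * i + true]%N = B i.
  apply/seteqP; split => t.
    rewrite /= /Z'; case: asboolP => /= [Bt|_] h.
      have -> : i = Z t by lia.
      by [].
    by lia.
  move=> Bt; have Zt : Z t = i := sB _ _ Bt.
  by rewrite /= /Z' Zt asboolT.
have Z'0 i : [set t | Z' t = 2 * i + false]%N = [set t | Z t = i] `\` B i.
  apply/seteqP; split => t.
    rewrite /= /Z'; case: asboolP => /= [_|Bt] h; first by lia.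
    have Zt : Z t = i by lia.
    by split => //; rewrite -Zt.
  move=> [/= Zt nB]; rewrite /Z' Zt asboolF //.
have Z'p i (b : bool) : pr [set t | Z' t = 2 * i + b]%N = pr [set t | Z t = i] / 2.
  case: b; first by rewrite Z'1 pB.
  by rewrite Z'0 prD// pB; lra.
exists Z'; split => //.
- move=> j; rewrite -(odd_double_half j) addnC -mul2n.
  case: (odd j); first by rewrite Z'1.
  by rewrite Z'0; apply: measurableD => //; exact: mZ.
- by move=> t; rewrite /Z'; case: `[< _ >] => /=; lia.
Qed.

Lemma dyadic_levels : exists Z : nat -> T -> nat, (forall t, Z 0%N t = 0%N) /\ forall n,
  [/\ nat_measurable (Z n),
      (forall t, 2 * Z n t <= Z n.+1 t <= 2 * Z n t + 1)%N &
      forall i, pr [set t | Z n t = i] = if (i < 2 ^ n)%N then 2^-1 ^+ n else 0].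
Proof.
have next Z : exists Z', nat_measurable Z -> [/\ nat_measurable Z',
    (forall t, 2 * Z t <= Z' t <= 2 * Z t + 1)%N &
    forall i (b : bool), pr [set t | Z' t = 2 * i + b]%N = pr [set t | Z t = i] / 2].
  have [mZ|nZ] := pselect (nat_measurable Z); last by exists Z.
  by have [Z' h] := split_level mZ; exists Z'.
have /choice[f hf] := next.
pose Z n := iter n f (fun=> 0%N).
have mZ n : nat_measurable (Z n).
  elim: n => [|n IH]; last by have [] := hf _ IH.
  move=> i; have [->|i0] := eqVneq i 0%N.
    by rewrite [X in measurable X](_ : _ = setT)//; apply/seteqP; split.
  rewrite [X in measurable X](_ : _ = set0)//; apply/seteqP; split => // t /= i0'.
  by move: i0; rewrite -i0'.
exists Z; split => // n; split => //; first by have [] := hf _ (mZ n).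
elim: n => [|n IH] i.
  case: i => [|i]; last first.
    rewrite expn0 ltnS ltn0 [X in pr X](_ : _ = set0) ?pr_set0//.
    by apply/seteqP; split.
  rewrite expn0 expr0 [X in pr X](_ : _ = setT) ?pr_setT//.
  by apply/seteqP; split.
have [_ _ h] := hf _ (mZ n).
rewrite -(odd_double_half i) addnC -mul2n h IH.
have -> : (2 * i./2 + odd i < 2 ^ n.+1)%N = (i./2 < 2 ^ n)%N.
  by rewrite expnS; apply/idP/idP; case: (odd i) => /=; lia.
by case: ifP => _; rewrite ?mul0r// exprSr.
Qed.

(** The minimum matters for [k = 2 ^ n + 1], which [uniform_source] reaches at
    [x = 1]. *)
Lemma pr_initial n (Z : T -> nat) k : nat_measurable Z ->
  (forall i, pr [set t | Z t = i] = if (i < 2 ^ n)%N then 2^-1 ^+ n else 0) ->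
  measurable [set t | Z t < k]%N /\
  pr [set t | Z t < k]%N = (minn k (2 ^ n))%:R * 2^-1 ^+ n.
Proof.
move=> mZ pZ; elim: k => [|k [mk IH]].
  rewrite [X in pr X](_ : _ = set0); last by apply/seteqP; split.
  rewrite [X in measurable X](_ : _ = set0); last by apply/seteqP; split.
  by rewrite pr_set0 min0n mul0r.
have -> : [set t | Z t < k.+1]%N = [set t | Z t < k]%N `|` [set t | Z t = k].
  apply/seteqP; split => t /=; last by case=> [/leqW|->].
  by rewrite ltnS leq_eqVlt => /orP[/eqP ->|->]; [right|left].
split; first exact: measurableU.
rewrite prU//; last first.
  by apply/seteqP; split => // t /= [+ e]; rewrite e ltnn.
rewrite IH pZ; case: ifP => h.
  have -> : minn k.+1 (2 ^ n) = k.+1 by apply/minn_idPl.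
  have -> : minn k (2 ^ n) = k by apply/minn_idPl; exact: ltnW.
  by rewrite -[k.+1%:R]natr1 mulrDl mul1r.
have {}h : (2 ^ n <= k)%N by rewrite leqNgt h.
have -> : minn k.+1 (2 ^ n) = (2 ^ n)%N by apply/minn_idPr; exact: leqW.
by have -> : minn k (2 ^ n) = (2 ^ n)%N by [apply/minn_idPr]; rewrite addr0.
Qed.

(** [u] has the binary digits built in [dyadic_levels].  Its distribution
    function at [x] is compared with those of the truncations to [n] digits. *)
Lemma uniform_source : exists u : T -> R, [/\ measurable_fun setT u,
  (forall t, 0 <= u t <= 1) &
  forall x, 0 <= x <= 1 -> pr [set t | u t <= x] = x].
Proof.
have [Z [Z0 hZ]] := dyadic_levels.
have mZ n : nat_measurable (Z n) by case: (hZ n).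
have sZ n t : (2 * Z n t <= Z n.+1 t <= 2 * Z n t + 1)%N by case: (hZ n).
have pZ n : forall i, pr [set t | Z n t = i] = if (i < 2 ^ n)%N then 2^-1 ^+ n else 0.
  by case: (hZ n).
have e0 n : 0 < 2^-1 ^+ n :> R by rewrite exprn_gt0.
have eS n : 2^-1 ^+ n = 2 * 2^-1 ^+ n.+1 :> R by rewrite exprS; lra.
pose lo n t : R := (Z n t)%:R * 2^-1 ^+ n.
pose up n t : R := (Z n t).+1%:R * 2^-1 ^+ n.
have lo_nd t : {homo lo ^~ t : n m / (n <= m)%N >-> n <= m}.
  apply/nondecreasing_seqP => n; rewrite /lo eS mulrA [_ * 2]mulrC -natrM.
  by rewrite ler_pM2r// ler_nat; case/andP: (sZ n t).
have up_ni t n : up n.+1 t <= up n t.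
  rewrite /up [leRHS](_ : _ = (2 * (Z n t).+1)%:R * 2^-1 ^+ n.+1).
    by rewrite ler_pM2r// ler_nat; case/andP: (sZ n t); lia.
  by rewrite natrM [in LHS]eS; ring.
have up_le t n m : (n <= m)%N -> up m t <= up n t.
  move=> /subnKC <-; elim: (m - n)%N => [|i IH]; first by rewrite addn0.
  by rewrite addnS (le_trans (up_ni _ _)).
have lo_up_n t n : lo n t <= up n t by rewrite /lo /up ler_pM2r// ler_nat.
have lo_up t n m : lo n t <= up m t.
  apply: le_trans (lo_nd t _ _ (leq_maxl n m)) _.
  by apply: le_trans (lo_up_n _ _) _; apply: up_le; exact: leq_maxr.
have ub t : has_ubound (range (lo ^~ t)).
  by exists (up 0%N t) => _ [n _ <-]; exact: lo_up.
pose u t := sup (range (lo ^~ t)).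
have lou t n : lo n t <= u t by apply: ub_le_sup => //; exists n.
have uup t n : u t <= up n t.
  apply: ge_sup; first by exists (lo 0%N t), 0%N.
  by move=> _ [m _ <-]; exact: lo_up.
have mu : measurable_fun setT u.
  apply: (@measurable_fun_cvg _ _ _ _ lo) => [n|t _].
    exact: (nat_measurable_fun (fun i => i%:R * 2^-1 ^+ n) (mZ n)).
  by apply: nondecreasing_cvgn.
exists u; split => // [t|x /andP[x0 x1]].
  apply/andP; split; first by apply: le_trans (lou t 0%N); rewrite /lo Z0 mul0r.
  by apply: le_trans (uup t 0%N) _; rewrite /up Z0 mul1r expr0.
have mux : measurable [set t | u t <= x].
  rewrite [X in measurable X](_ : _ = u @^-1` `]-oo, x]).
    by rewrite -[X in measurable X]setTI; apply: mu => //; exact: measurable_itv.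
  by apply/seteqP; split => t /=; rewrite in_itv.
have e2 n : (2 ^ n)%:R * 2^-1 ^+ n = 1 :> R.
  by rewrite natrX -exprMn mulfV ?expr1n.
have bnd n : `|pr [set t | u t <= x] - x| <= 2^-1 ^+ n.
  pose k := Num.truncn (x * (2 ^ n)%:R).
  have /andP[k1 k2] := truncn_itv (mulr_ge0 x0 (ler0n R (2 ^ n))).
  rewrite -/k in k1 k2.
  have e2x : x = x * (2 ^ n)%:R * 2^-1 ^+ n by rewrite -mulrA e2 mulr1.
  have k1' : k%:R * 2^-1 ^+ n <= x.
    by rewrite [leRHS]e2x ler_pM2r.
  have k2' : x < k.+1%:R * 2^-1 ^+ n.
    by rewrite [ltLHS]e2x ltr_pM2r.
  have kn : (k <= 2 ^ n)%N.
    rewrite -(ler_nat R); apply: le_trans k1 _; rewrite -[leRHS]mul1r.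
    by rewrite ler_wpM2r.
  have [m1 p1] := pr_initial k (mZ n) (pZ n).
  have [m2 p2] := pr_initial k.+1 (mZ n) (pZ n).
  have h1 : pr [set t | Z n t < k]%N <= pr [set t | u t <= x].
    apply: pr_le => // t /= Zk; apply: le_trans (uup t n) _; apply: le_trans k1'.
    by rewrite /up ler_pM2r// ler_nat.
  have h2 : pr [set t | u t <= x] <= pr [set t | Z n t < k.+1]%N.
    apply: pr_le => // t /= ux; have := le_lt_trans (le_trans (lou t n) ux) k2'.
    by rewrite /lo ltr_pM2r// ltr_nat.
  have h3 : (minn k.+1 (2 ^ n))%:R * 2^-1 ^+ n <= k.+1%:R * 2^-1 ^+ n :> R.
    by rewrite ler_pM2r// ler_nat geq_minl.
  rewrite (minn_idPl kn) in p1.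
  have e3 : k.+1%:R * 2^-1 ^+ n = k%:R * 2^-1 ^+ n + 2^-1 ^+ n :> R.
    by rewrite -[k.+1%:R]natr1 mulrDl mul1r.
  by rewrite ler_norml; apply/andP; split; lra.
apply/eqP; rewrite -subr_eq0 -normr_le0; apply/ler_addgt0Pr => z z0; rewrite add0r.
have [|m h] := @exists_small_power R 2^-1 z _ z0; first by apply/andP; split; lra.
exact: le_trans (bnd m) h.
Qed.

End pr.

(** * Realising mixtures of boxes *)

Section realise.
Context {R : realType} {d : measure_display} {T : measurableType d}.
Context (P : probability T R).
Local Notation pr := (pr P).

Lemma uniform_prob01E (A : set R) : measurable A ->
  uniform_prob (@ltr01 R) A = lebesgue_measure (A `&` `[0, 1]).
Proof.
move=> mA; rewrite /uniform_prob integral_uniform_pdf.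
rewrite (eq_integral (cst 1%E)) => [|x]; last first.
  by rewrite inE => -[_]; rewrite /= in_itv /= /uniform_pdf => ->; rewrite subr0 invr1.
by rewrite integral_cst ?mul1e//; exact: measurableI.
Qed.

Lemma measurable_le_set (f : T -> R) y : measurable_fun setT f ->
  measurable [set t | f t <= y].
Proof.
move=> mf; rewrite [X in measurable X](_ : _ = f @^-1` `]-oo, y]).
  by rewrite -[X in measurable X]setTI; apply: mf => //; exact: measurable_itv.
by apply/seteqP; split => t /=; rewrite in_itv.
Qed.

Lemma measurable_id_real :
  @measurable_fun _ _ (measurableTypeR R) (R : measurableType _) setT idfun.
Proof. by move=> _ Y mY; rewrite setTI preimage_id. Qed.

(** The reals carry two convertible but differently built measurable structures,
    one for the values of random variables and one for the Lebesgue measure;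
    pushing forward along this identity goes from the second to the first. *)
Definition id_real : {mfun measurableTypeR R >-> (R : measurableType _)} :=
  @mfun_Sub _ _ (measurableTypeR R) (R : measurableType _) idfun (mem_set measurable_id_real).

(** Open half-lines are stable under intersection and generate the Borel sets. *)
Lemma uniform01_of_cdf (U : {RV P >-> R}) :
  (forall t, 0 <= U t <= 1) ->
  (forall y, 0 <= y <= 1 -> pr [set t | U t <= y] = y) -> uniform01 U.
Proof.
move=> U01 Uc; split => // A mA.
have mU : measurable_fun setT U by [].
pose g n : set R := `](- n%:R : R), +oo[%classic.
apply: (@measure_unique _ R _ (@RGenOInfty.G R) g _ _ _ _ (distribution P U)
  (distribution (uniform_prob (@ltr01 R)) id_real) _ _ A mA).
- exact: RGenOInfty.measurableE.
- move=> _ _ [x ->] [y ->]; exists (Num.max x y); apply/seteqP; split => z /=.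
    by rewrite !in_itv /= !andbT gt_max => -[-> ->].
  by rewrite !in_itv /= !andbT gt_max => /andP[].
- by move=> i; exists (- i%:R).
- apply/seteqP; split => // x _; exists (Num.truncn `|x|).+1 => //=.
  rewrite /g /= in_itv /= andbT.
  have /andP[_ h] := truncn_itv (normr_ge0 x).
  by have := ler_norm (- x); rewrite normrN; lra.
- move=> _ [x ->]; rewrite [RHS]uniform_prob01E; last exact: measurable_itv.
  rewrite -[LHS]/(P (U @^-1` `]x, +oo[)).
  rewrite -[RHS]/(lebesgue_measure (`]x, +oo[%classic `&` `[0, 1]%classic)).
  have [x0|x0] := ltP x 0.
    rewrite [X in P X](_ : _ = setT); last first.
      apply/seteqP; split => // t _ /=; rewrite in_itv /= andbT.
      by case/andP: (U01 t) => + _; exact: lt_le_trans.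
    rewrite probability_setT [X in lebesgue_measure X](_ : _ = `[0, 1]%classic); last first.
      apply/seteqP; split => y /=; rewrite !in_itv /= ?andbT; first by case.
      by move=> /andP[y0 y1]; rewrite y0 y1; split => //; exact: lt_le_trans y0.
    by rewrite lebesgue_measure_itv /= lte_fin ltr01 oppr0 adde0.
  have [x1|x1] := ltP 1 x.
    rewrite [X in P X](_ : _ = set0); last first.
      apply/seteqP; split => // t /=; rewrite in_itv /= andbT => h.
      by case/andP: (U01 t) => _ h'; lra.
    rewrite measure0 [X in lebesgue_measure X](_ : _ = set0) ?measure0//.
    by apply/seteqP; split => // y /=; rewrite !in_itv /= ?andbT; case=> ? /andP[_ ?]; lra.
  rewrite [X in P X](_ : _ = setT `\` [set t | U t <= x]); last first.
    apply/seteqP; split => t /=; rewrite in_itv /= andbT.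
      by move=> h; split => //; apply/negP; rewrite -ltNge.
    by move=> [_ /negP]; rewrite -ltNge.
  rewrite prE; last by apply: measurableD => //; exact: measurable_le_set.
  rewrite prD//; last exact: measurable_le_set.
  rewrite pr_setT Uc ?x0//.
  rewrite [X in lebesgue_measure X](_ : _ = `]x, 1]%classic); last first.
    apply/seteqP; split => y /=; rewrite !in_itv /= ?andbT.
      by move=> [-> /andP[_ ->]].
    by move=> /andP[xy y1]; rewrite xy y1; split => //; rewrite andbT (le_trans x0)// ltW.
  rewrite lebesgue_measure_itv /= lte_fin; case: ltP => // x1'.
  by have -> : x = 1 by [apply/eqP; rewrite eq_le x1]; rewrite subrr.
- by move=> k; rewrite (le_lt_trans (probability_le1 _ _)) ?ltry//; exact: measurable_itv.
Qed.

Lemma uniform01_cdf (U : {RV P >-> R}) (y : R) : uniform01 U -> 0 <= y <= 1 ->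
  pr [set t | U t <= y] = y.
Proof.
move=> [U01 hU] /andP[y0 y1].
have mU : measurable [set t | U t <= y] by exact: measurable_le_set.
apply: EFin_inj; rewrite -prE//.
rewrite [X in P X](_ : _ = U @^-1` `]-oo, y]); last first.
  by apply/seteqP; split => t /=; rewrite in_itv.
have := hU `]-oo, y]%classic (measurable_itv _); rewrite /distribution /pushforward => ->.
rewrite uniform_prob01E; last exact: measurable_itv.
rewrite (_ : _ `&` _ = `[0, y]%classic); last first.
  apply/seteqP; split => x /=; rewrite !in_itv /=; first by move=> [-> /andP[-> _]].
  by move=> /andP[-> h1]; rewrite h1; split => //; rewrite (le_trans h1).
rewrite lebesgue_measure_itv /= lte_fin; case: ltP => [_|y0'].
  by rewrite oppr0 adde0.
by have -> : y = 0 by apply/eqP; rewrite eq_le y0'.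
Qed.

Definition rv_of (f : T -> R) (mf : measurable_fun setT f) : {RV P >-> R} :=
  mfun_Sub (mem_set mf).

Context (K : nat).
Implicit Type s : seq (R * ('I_K -> R * R)).

(** The interval of [x] after [c] is cut into pieces of lengths [p.1]; on each of
    them the [k]-th coordinate runs affinely through the [k]-th side of the box.
    Evaluated at a uniform variable this realises the mixture [s], all
    coordinates being driven by the same variable. *)
Fixpoint glue s (k : 'I_K) (c x : R) : R :=
  if s is p :: s' then
    if x <= c + p.1 then (p.2 k).1 + ((p.2 k).2 - (p.2 k).1) * ((x - c) / p.1)
    else glue s' k (c + p.1) x
  else 0.

Lemma measurable_glue s k c : measurable_fun setT (glue s k c).
Proof.
elim: s c => [|p s IH] c /=; first exact: measurable_cst.
apply: measurable_fun_ifT => //=.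
- by apply: measurable_fun_ler => //; exact: measurable_cst.
- apply: measurable_funD; first exact: measurable_cst.
  apply: measurable_funM; first exact: measurable_cst.
  apply: measurable_funM; last exact: measurable_cst.
  by apply: measurable_funB => //; exact: measurable_cst.
Qed.

Lemma affine_between (a lo hi : R) : 0 <= a <= 1 -> lo <= hi ->
  lo <= lo + (hi - lo) * a <= hi.
Proof. by move=> /andP[a0 a1] lh; apply/andP; split; nra. Qed.

Lemma glue01 s k c x : proper_boxes s -> c <= x -> 0 <= glue s k c x <= 1.
Proof.
elim: s c => [|p s IH] c /=; first by rewrite lexx ler01.
move=> /andP[/andP[p0 /forallP/(_ k) /andP[/andP[l0 lh] h1]] ps] cx.
case: ifPn => [xp|xp]; last by apply: IH => //; rewrite -ltNge in xp; exact: ltW.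
have a01 : 0 <= (x - c) / p.1 <= 1.
  rewrite divr_ge0 ?subr_ge0 ?(ltW p0)//= ler_pdivrMr// mul1r; lra.
have := affine_between a01 (ltW lh); lra.
Qed.

Context (u : T -> R) (mu : measurable_fun setT u) (u01 : forall t, 0 <= u t <= 1).
Context (uc : forall x, 0 <= x <= 1 -> pr [set t | u t <= x] = x).

Lemma pr_band a b : 0 <= a -> a <= b -> b <= 1 ->
  measurable [set t | (a < u t) && (u t <= b)] /\
  pr [set t | (a < u t) && (u t <= b)] = b - a.
Proof.
move=> a0 ab b1.
have -> : [set t | (a < u t) && (u t <= b)] = [set t | u t <= b] `\` [set t | u t <= a].
  apply/seteqP; split => t /=.
    by move=> /andP[h ->]; split => //; apply/negP; rewrite -ltNge.
  by move=> [-> /negP]; rewrite -ltNge => ->.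
have mb := measurable_le_set b mu; have ma := measurable_le_set a mu.
split; first exact: measurableD.
rewrite prD//; last by move=> t /= h; exact: le_trans ab.
by rewrite !uc// ?(le_trans a0 ab) ?b1 ?a0 ?(le_trans ab b1).
Qed.

Lemma measurable_above c (Q : set T) : measurable Q ->
  measurable [set t | c < u t /\ Q t].
Proof.
move=> mQ; have -> : [set t | c < u t /\ Q t] = Q `\` [set t | u t <= c].
  apply/seteqP; split => t /=; first by move=> [h q]; split => //; apply/negP; rewrite -ltNge.
  by move=> [q /negP]; rewrite -ltNge.
by apply: measurableD => //; exact: measurable_le_set.
Qed.

Lemma measurable_glue_u s k c : measurable_fun setT (fun t => glue s k c (u t)).
Proof. by apply: measurableT_comp => //; exact: measurable_glue. Qed.

Lemma glue_cdf s k c y : proper_boxes s -> 0 <= c -> c + \sum_(p <- s) p.1 = 1 ->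
  pr [set t | c < u t /\ glue s k c (u t) <= y] =
  \sum_(p <- s) p.1 * ramp (p.2 k).1 (p.2 k).2 y.
Proof.
elim: s c => [|p s IH] c.
  rewrite !big_nil addr0 => _ _ c1; rewrite [X in pr X](_ : _ = set0) ?pr_set0//.
  by apply/seteqP; split => // t /= [+ _]; rewrite c1 ltNge; case/andP: (u01 t) => _ ->.
move=> /= /andP[/andP[p0 /forallP/(_ k) /andP[/andP[l0 lh] h1]] ps] c0.
rewrite big_cons => sE; rewrite big_cons -(IH (c + p.1))//; last 2 first.
  by rewrite addr_ge0// ltW.
  by rewrite -addrA.
set lo := (p.2 k).1 in l0 lh *; set hi := (p.2 k).2 in lh h1 *.
set z := ramp lo hi y.
have S0 : 0 <= \sum_(p <- s) p.1.
  by apply: sum_all_ge0; apply: sub_all ps => q /andP[/ltW].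
have z01 : 0 <= z <= 1 by rewrite /z /ramp le_max lexx /= ge_max ler01 ge_min lexx.
have /andP[z0 z1] := z01.
have d0 : 0 < hi - lo by rewrite subr_gt0.
have [mb pb] : measurable [set t | (c < u t) && (u t <= c + p.1 * z)] /\
    pr [set t | (c < u t) && (u t <= c + p.1 * z)] = p.1 * z.
  have h : p.1 * z <= p.1 by rewrite ler_piMr// ltW.
  have h' : 0 <= p.1 * z by rewrite mulr_ge0// ltW.
  have [| | |m e] := @pr_band c (c + p.1 * z); rewrite ?ler_wpDr//; first lra.
  by split => //; rewrite e; ring.
rewrite -pb -prU//.
- congr (pr _); apply/seteqP; split => t /=.
    move=> [cu]; case: ifPn => [up gy|]; last first.
      by rewrite -ltNge => up gy; right.
    left; rewrite cu /=; rewrite -lerBlDl -ler_pdivrMl// mulrC.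
    have a01 : (u t - c) / p.1 <= 1 by rewrite ler_pdivrMr// mul1r lerBlDl.
    rewrite /z /ramp le_max le_min a01 /=; apply/orP; right.
    by rewrite ler_pdivlMr//; lra.
  move=> [/andP[cu up]|[cu gy]]; last first.
    have cu' : c < u t by apply: lt_trans cu; rewrite ltrDl.
    by split => //; rewrite (leNgt (u t)) cu.
  split => //.
  have -> : u t <= c + p.1 by apply: le_trans up _; rewrite lerD2l ler_piMr// ltW.
  have a0 : 0 < (u t - c) / p.1 by rewrite divr_gt0// subr_gt0.
  have az : (u t - c) / p.1 <= z by rewrite ler_pdivrMr// mulrC lerBlDl.
  have zpos : 0 < z by exact: lt_le_trans az.
  have : z <= (y - lo) / (hi - lo).
    move: zpos; rewrite /z /ramp lt_max ltxx /= => h.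
    by rewrite max_r; [rewrite ge_min lexx orbT|exact: ltW].
  rewrite ler_pdivlMr// => zy.
  by have := ler_wpM2r (ltW d0) az; lra.
- by apply: measurable_above; apply: measurable_le_set; exact: measurable_glue_u.
- apply/seteqP; split => // t /= [/andP[_ h] [h' _]].
  have : p.1 * z <= p.1 by rewrite ler_piMr// ltW.
  lra.
Qed.

(** On the piece of a good box all coordinates lie below its upper corner. *)
Lemma glue_good s c (Q : ('I_K -> R) -> Prop) (good : pred (R * ('I_K -> R * R))) :
  (forall s c, measurable [set t | Q (fun k => glue s k c (u t))]) ->
  (forall p v, good p -> (forall k, 0 <= v k <= (p.2 k).2) -> Q v) ->
  proper_boxes s -> 0 <= c -> c + \sum_(p <- s) p.1 = 1 ->
  \sum_(p <- s | good p) p.1 <= pr [set t | c < u t /\ Q (fun k => glue s k c (u t))].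
Proof.
move=> mQ hQ; elim: s c => [|p s IH] c.
  by move=> _ _ _; rewrite big_nil pr_ge0.
move=> ps0; have := ps0 => /= /andP[/andP[p0 /forallP hp] ps] c0.
rewrite big_cons => sE; rewrite big_cons.
have sE' : c + p.1 + \sum_(p <- s) p.1 = 1 by rewrite -addrA.
have c0' : 0 <= c + p.1 by rewrite addr_ge0// ltW.
have S0 : 0 <= \sum_(p <- s) p.1.
  by apply: sum_all_ge0; apply: sub_all ps => q /andP[/ltW].
have IH' := IH _ ps c0' sE'.
set X := [set t | c < u t /\ _].
have mX : measurable X by apply: measurable_above; exact: (mQ (p :: s)).
set Y := [set t | c + p.1 < u t /\ _] in IH'.
have mY : measurable Y by apply: measurable_above; exact: mQ.
have YX : Y `<=` X.
  move=> t [h q]; have cp : c < c + p.1 by rewrite ltrDl.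
  split; first exact: lt_trans cp h.
  by rewrite /= (leNgt (u t)) h.
case: ifP => gp; last by apply: le_trans IH' _; exact: pr_le.
have [|||mb pb] := @pr_band c (c + p.1); rewrite ?lerDl ?(ltW p0)//; first lra.
rewrite -[p.1](addrK c) [p.1 + c]addrC -pb.
apply: le_trans (lerD (lexx _) IH') _; rewrite -prU//; last first.
  by apply/seteqP; split => // t /= [/andP[_ h] [h' _]]; lra.
apply: pr_le => //; first exact: measurableU.
move=> t /= [/andP[cu up]|]; last exact: YX.
split => //; apply: (hQ p) => // k.
have /andP[/andP[l0 lh] h1] := hp k.
rewrite up.
have a01 : 0 <= (u t - c) / p.1 <= 1.
  by rewrite divr_ge0 ?subr_ge0 ?(ltW p0) ?(ltW cu)//= ler_pdivrMr// mul1r lerBlDl.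
by have := affine_between a01 (ltW lh); move=> /andP[h ->]; rewrite (le_trans l0 h).
Qed.

Lemma realise_boxes s (Q : ('I_K -> R) -> Prop) (good : pred (R * ('I_K -> R * R))) :
  uniform_boxes s ->
  (forall f : 'I_K -> T -> R, (forall k, measurable_fun setT (f k)) ->
     measurable [set t | Q (f ^~ t)]) ->
  (forall p v, good p -> (forall k, 0 <= v k <= (p.2 k).2) -> Q v) ->
  exists U : 'I_K -> {RV P >-> R}, (forall k, uniform01 (U k)) /\
    \sum_(p <- s | good p) p.1 <= pr [set t | Q (fun k => U k t)].
Proof.
move=> [ps s1 sr] mQ hQ.
have mg k := measurable_glue_u s k 0.
exists (fun k => rv_of (mg k)); split => [k|]; last first.
  apply: le_trans (@glue_good s 0 Q good _ hQ ps (lexx 0) _) _.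
  - by move=> s' c; apply: (mQ (fun k t => glue s' k c (u t))) => k; exact: measurable_glue_u.
  - by rewrite add0r.
  have m1 := mQ (fun k t => glue s k 0 (u t)) mg.
  by apply: pr_le => //; [exact: measurable_above|move=> t /= []].
apply: uniform01_of_cdf => [t|y y01] /=.
  by apply: glue01 => //; case/andP: (u01 t).
rewrite -[RHS](sr k y y01) -(@glue_cdf s k 0 y)// ?add0r//.
have m1 : measurable [set t | glue s k 0 (u t) <= y] by exact: measurable_le_set.
have m2 := measurable_above 0 m1.
have m3 := measurable_le_set 0 mu.
apply/eqP; rewrite eq_le; apply/andP; split; last by apply: pr_le => // t [].
have p3 : pr [set t | u t <= 0] = 0 by rewrite uc// lexx ler01.
set X := [set t | 0 < u t /\ _] in m2 *; set Y := [set t | u t <= 0] in m3 p3.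
have XY : X `&` Y = set0.
  by apply/seteqP; split => // t /= [[h _] h']; move: h'; rewrite /Y /= leNgt h.
have -> : pr X = pr (X `|` Y) by rewrite prU// p3 addr0.
apply: pr_le => //; first exact: measurableU.
by move=> t /= h; have [h0|h0] := leP (u t) 0; [right|left].
Qed.
End realise.

(** * Approaching the level *)

Section attain.
Context {R : realType} {d : measure_display} {T : measurableType d}.
Context (P : probability T R).
Local Notation pr := (pr P).

Lemma measurable_weighted_powers (K : nat) (w : 'I_K -> R) (r b : R)
    (f : 'I_K -> T -> R) : (forall k, measurable_fun setT (f k)) ->
  measurable [set t | \sum_k w k * f k t `^ r <= b].
Proof.
move=> mf; apply: (measurable_le_set (f := fun t => \sum_k w k * f k t `^ r)).
apply: measurable_sum => k; apply: measurable_funM => //.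
by apply: (measurableT_comp (measurable_powR r)).
Qed.

Lemma ramp_scale (a lo hi y : R) : 0 < a ->
  ramp (a * lo) (a * hi) y = ramp lo hi (y / a).
Proof.
move=> a0; rewrite /ramp; congr (Num.max 0 (Num.min 1 _)).
have an0 : a != 0 by rewrite gt_eqF.
rewrite -mulrBr invfM mulrA; congr (_ * _).
by rewrite mulrBl mulrAC mulfV// mul1r.
Qed.

Lemma ramp_ge (lo hi y : R) : lo < hi -> hi <= y -> ramp lo hi y = 1.
Proof.
move=> lh hy; have h0 : 0 < hi - lo by rewrite subr_gt0.
by rewrite /ramp min_l ?max_r// ler_pdivlMr// mul1r lerD2r.
Qed.

Lemma ramp_le_lo (lo hi y : R) : lo < hi -> y <= lo -> ramp lo hi y = 0.
Proof.
move=> lh hy; have h0 : 0 < hi - lo by rewrite subr_gt0.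
by rewrite /ramp max_l// ge_min ler_pdivrMr// mul0r subr_le0 hy orbT.
Qed.

(** The mixture shrunk to [[0, a]], completed by the box with all sides [[a, 1]]. *)
Definition scale_boxes (K : nat) (a : R) (s : seq (R * ('I_K -> R * R))) :=
  rcons [seq (a * p.1, fun k => (a * (p.2 k).1, a * (p.2 k).2)) | p <- s]
        (1 - a, fun=> (a, 1)).

Lemma scale_boxes_uniform (K : nat) (a : R) (s : seq (R * ('I_K -> R * R))) :
  0 < a < 1 -> uniform_boxes s -> uniform_boxes (scale_boxes a s).
Proof.
move=> /andP[a0 a1] [ps s1 sr]; split.
- rewrite /proper_boxes all_rcons all_map; apply/andP; split.
    by rewrite /= subr_gt0 a1; apply/forallP => k; rewrite ltW //= a1 lexx.
  apply: sub_all ps => p /andP[p0 /forallP h]; rewrite /= mulr_gt0//=.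
  apply/forallP => k; have /andP[/andP[l0 lh] h1] := h k.
  rewrite mulr_ge0 ?(ltW a0)//= ltr_pM2l// lh /= (le_trans _ (ltW a1))//.
  by rewrite ler_piMr// ltW.
- rewrite /scale_boxes big_rcons /= big_map /= -big_distrr /= s1; ring.
- move=> k y y01; rewrite /scale_boxes big_rcons /= big_map /=.
  under eq_bigr do rewrite ramp_scale// -mulrA.
  have /andP[y0 y1] := y01.
  rewrite -big_distrr /=; have [ya|ya] := leP y a.
    rewrite sr; last by rewrite divr_ge0 ?(ltW a0)//= ler_pdivrMr// mul1r.
    by rewrite mulrC divfK ?gt_eqF// ramp_le_lo// mulr0 addr0.
  rewrite (_ : \sum_(p <- s) _ = 1); last first.
    rewrite -[RHS]s1; elim: (s) ps => [|p s' IH] /=; first by rewrite !big_nil.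
    move=> /andP[/andP[p0 /forallP/(_ k)/andP[/andP[l0 lh] h1]] /IH h].
    rewrite !big_cons h ramp_ge ?mulr1// (le_trans h1)// ler_pdivlMr// mul1r ltW//.
  rewrite mulr1 /ramp.
  have a1' : 0 < 1 - a by rewrite subr_gt0.
  rewrite min_r; last by rewrite ler_pdivrMr// mul1r lerD2r.
  rewrite max_r; last by rewrite divr_ge0// subr_ge0 ltW.
  by rewrite mulrC divfK ?gt_eqF//; ring.
Qed.

(** The nearly constant sum of [mean_power_boxes] exceeds [1/(r+1)] by up to
    [d1].  Scaling by [a] slightly smaller than [e] instead of [e] absorbs this
    excess, at the cost of a probability [a (1 - d1)] in place of [e]. *)
Lemma near_precise (K : nat) (w : 'I_K -> R) (r e z : R) : atomless P ->
  (2 <= K)%N -> (forall k, 0 <= w k) -> \sum_k w k = 1 -> 0 < r ->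
  (forall k, w k * (r + 1) <= 1) -> (forall k, w k * (r + 1) <= r) ->
  0 < e < 1 -> 0 < z ->
  exists U : 'I_K -> {RV P >-> R}, (forall k, uniform01 (U k)) /\
    e - z <= pr [set t | \sum_k w k * U k t `^ r <= e `^ r / (r + 1)].
Proof.
move=> hP K2 w0 wS r0 wm1 wm2 /andP[e0 e1] z0.
have rr0 : 0 < r + 1 by lra.
have [u [mu u01 uc]] := uniform_source hP.
(* The maximum with [e / 2] only keeps [a] positive. *)
pose a := Num.max (e / 2) (e - z / 2).
have a0 : 0 < a by rewrite lt_max divr_gt0.
have ae : a < e by rewrite gt_max; apply/andP; split; lra.
have az : e - z / 2 <= a by rewrite le_max lexx orbT.
have apos : 0 < a `^ r by rewrite powR_gt0.
have aer : a `^ r < e `^ r by apply: gt0_ltr_powR; rewrite ?nnegrE ?ltW.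
pose d0 := (e `^ r / a `^ r - 1) / (r + 1).
have d00 : 0 < d0 by rewrite divr_gt0// subr_gt0 ltr_pdivlMr// mul1r.
pose d1 := Num.min d0 (z / 2).
have d10 : 0 < d1 by rewrite lt_min d00 divr_gt0.
have [s [us sg]] := mean_power_boxes K2 w0 wS r0 wm1 wm2 d10.
have a01 : 0 < a < 1 by rewrite a0 (lt_trans ae).
have us' := scale_boxes_uniform a01 us.
pose b := e `^ r / (r + 1).
pose Q (v : 'I_K -> R) := \sum_k w k * v k `^ r <= b.
pose good (p : R * ('I_K -> R * R)) := \sum_k w k * (p.2 k).2 `^ r <= b.
have [|p v hp hv|U [hU hg]] := @realise_boxes _ _ _ P K u mu u01 uc _ Q good us'.
- by move=> f mf; exact: measurable_weighted_powers.
- apply: le_trans hp; apply: ler_sum => k _; rewrite ler_wpM2l//.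
  by have /andP[h1 h2] := hv k; apply: ge0_powR_le => //; exact: ltW.
exists U; split => //; apply: le_trans hg.
rewrite /scale_boxes -cats1 big_cat /= big_map /= ler_wpDr//.
  by rewrite big_mkcond big_seq1 /=; case: ifP => // _; rewrite subr_ge0; case/andP: a01 => _ /ltW.
rewrite -big_distrr /=.
apply: (@le_trans _ _ (a * (1 - d1))).
  have : d1 <= z / 2 by rewrite ge_min lexx orbT.
  have : a <= 1 by case/andP: a01 => _ /ltW.
  by move=> h1 h2; nra.
rewrite ler_pM2l//; apply: le_trans sg _.
have [ps _ _] := us.
apply: (le_sum_filter ps) => [p /andP[/ltW//]|p /andP[_ /forallP hp] h].
rewrite /good /=.
have -> : \sum_k w k * (a * (p.2 k).2) `^ r = a `^ r * \sum_k w k * (p.2 k).2 `^ r.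
  rewrite big_distrr /=; apply: eq_bigr => k _; rewrite powRM ?(ltW a0)//.
    by rewrite mulrCA.
  by have /andP[/andP[l0 lh] _] := hp k; exact: le_trans (ltW lh).
apply: (@le_trans _ _ (a `^ r * ((r + 1)^-1 + d0))).
  rewrite ler_pM2l//; apply: le_trans h _; rewrite lerD2l ge_min lexx //.
rewrite /d0 /b le_eqVlt; apply/orP; left; apply/eqP; field.
by rewrite !gt_eqF.
Qed.

(** * The dual bound *)

Lemma expectation_step (U : {RV P >-> R}) (phi Phi : R -> R) (s e : R) :
  uniform01 U -> measurable_fun setT phi -> 0 < s -> s < e -> e <= 1 ->
  (forall x : R, 0 < x -> is_derive x 1 Phi (phi x)) ->
  (forall x : R, 0 < x -> derivable phi x 1) ->
  (forall x : R, s <= x <= e -> phi e <= phi x) ->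
  (\int[P]_t (if s <= U t <= e then phi (U t) - phi e else 0)%:E
    = (Phi e - Phi s - (e - s) * phi e)%:E)%E.
Proof.
move=> [U01 hU] mphi s0 se e1 dPhi dphi phi_le.
pose g (x : R) : \bar R := (if s <= x <= e then phi x - phi e else 0)%:E.
have g0 x : (0 <= g x)%E.
  by rewrite /g lee_fin; case: ifP => // /phi_le h; rewrite subr_ge0.
have mg : measurable_fun setT g.
  apply/measurable_EFinP; apply: measurable_fun_ifT => //=.
    by apply: measurable_and; apply: measurable_fun_ler.
  exact: measurable_funB.
transitivity (\int[distribution P U]_x g x)%E.
  by rewrite (@ge0_integral_distribution _ _ _ _ _ P U g mg g0).
rewrite (@eq_measure_integral _ _ _ _ (distribution (uniform_prob (@ltr01 R)) id_real)); last first.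
  by move=> A mA _; exact: hU.
rewrite ge0_integral_distribution//.
rewrite integral_uniform//= subr0 invr1 mul1e.
transitivity (\int[lebesgue_measure]_(x in `[s, e]) (phi x - phi e)%:E)%E.
  rewrite [in RHS](_ : `[s, e]%classic = `[0, 1]%classic `&` `[s, e]%classic); last first.
    apply/seteqP; split => x /=; rewrite !in_itv /=; last by case.
    move=> /andP[h1 h2]; rewrite h1 h2; split => //.
    by rewrite (le_trans (ltW s0) h1) (le_trans h2 e1).
  rewrite integral_mkcondr; apply: eq_integral => x _.
  rewrite /g /= patchE /=; case: ifPn; first by move=> h; rewrite ifT// inE /= in_itv.
  by move=> h; rewrite ifF//; apply/negbTE; rewrite notin_setE /= in_itv /=; exact/negP.
pose F x := Phi x - x * phi e.
have dF (x : R) : 0 < x -> is_derive x 1 F (phi x - phi e).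
  move=> x0; apply: (is_derive_eq (is_deriveB (dPhi x x0)
    (is_deriveM (is_derive_id x 1) (is_derive_cst (phi e) x 1)))).
  by rewrite scaler0 add0r; congr (_ - _); exact: mulr1.
have dF' (x : R) : 0 < x -> derivable F x 1 by move=> x0; have [] := dF x x0.
rewrite (@continuous_FTC2 _ (fun x => phi x - phi e) F)//.
- by rewrite -EFinB /F; congr (_%:E); ring.
- apply: derivable_within_continuous => x; rewrite in_itv /= => /andP[sx _].
  by apply: derivableB => //; apply: dphi; exact: lt_le_trans sx.
- split.
  + by move=> x; rewrite in_itv /= => /andP[sx _]; apply: dF'; exact: lt_trans sx.
  + apply: cvg_at_right_filter; apply/differentiable_continuous/derivable1_diffP.
    exact: dF'.
  + apply: cvg_at_left_filter; apply/differentiable_continuous/derivable1_diffP.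
    by apply: dF'; exact: lt_trans se.
- move=> x; rewrite in_itv /= => /andP[sx _].
  have x0 : 0 < x by exact: lt_trans sx.
  by rewrite derive1E; have [_ ->] := dF x x0.
Qed.

(** The indicator of [A], multiplied by [D], is at most the sum over [k] of the
    functions [h k] of [U k] alone that are [D] below [s k] and
    [w k * (phi - phi e)] on [[s k, e]]: if some [U k] is below [s k] its term is
    enough, otherwise this is the hypothesis on [A].  The expectation of
    [h k] depends on the law of [U k] only, whatever the joint law. *)
Lemma dual_bound (K : nat) (U : 'I_K -> {RV P >-> R}) (w s : 'I_K -> R)
    (phi Phi : R -> R) (e D : R) (A : set T) :
  (forall k, uniform01 (U k)) -> (forall k, 0 <= w k) -> measurable A ->
  measurable_fun setT phi -> e <= 1 -> (forall k, 0 < s k < e) -> 0 <= D ->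
  (forall x : R, 0 < x -> is_derive x 1 Phi (phi x)) ->
  (forall x : R, 0 < x -> derivable phi x 1) ->
  (forall x : R, 0 < x -> x <= e -> phi e <= phi x) ->
  (forall t, A t -> (forall k, s k < U k t) ->
     D <= \sum_k w k * Num.max 0 (if U k t <= e then phi (U k t) - phi e else 0)) ->
  D * pr A <= \sum_k (D * s k + w k * (Phi e - Phi (s k) - (e - s k) * phi e)).
Proof.
move=> hU w0 mA mphi e1 se D0 dPhi dphi phi_le hA.
pose g k (x : R) := if s k <= x <= e then phi x - phi e else 0.
have s0 k : 0 < s k by case/andP: (se k).
have g0 k x : 0 <= g k x.
  rewrite /g; case: ifP => // /andP[h1 h2]; rewrite subr_ge0 phi_le//.
  exact: lt_le_trans h1.
have mg k : measurable_fun setT (g k).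
  apply: measurable_fun_ifT => //=.
    by apply: measurable_and; apply: measurable_fun_ler.
  exact: measurable_funB.
have mI k : measurable [set t | U k t <= s k] by exact: measurable_le_set.
pose h k t : R := D * \1_[set t | U k t <= s k] t + w k * g k (U k t).
have h0 k t : 0 <= h k t by rewrite addr_ge0 ?mulr_ge0.
have mh k : measurable_fun setT (h k).
  apply: measurable_funD; apply: measurable_funM => //.
  by apply: measurableT_comp.
have Eh k : (\int[P]_t (h k t)%:E =
    (D * s k + w k * (Phi e - Phi (s k) - (e - s k) * phi e))%:E)%E.
  rewrite /h; under eq_integral do rewrite EFinD !EFinM.
  rewrite ge0_integralD//=; first last.
  - by apply/measurable_EFinP/measurable_funM => //; apply: measurableT_comp.
  - by move=> t _; rewrite -EFinM lee_fin mulr_ge0.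
  - by apply/measurable_EFinP/measurable_funM.
  - by move=> t _; rewrite -EFinM lee_fin mulr_ge0.
  rewrite !ge0_integralZl_EFin//; do ?[by apply/measurable_EFinP
    |by move=> t _; rewrite lee_fin
    |by apply/measurable_EFinP; apply: measurableT_comp].
  have /andP[sk0 ske] := se k.
  rewrite (@expectation_step (U k) phi Phi (s k) e)//; last first.
    by move=> x /andP[h1 h2]; apply: phi_le => //; exact: lt_le_trans h1.
  have Pk : P [set t | U k t <= s k] = (s k)%:E.
    by rewrite (prE P (mI k)) uniform01_cdf// ltW//= (le_trans _ e1)// ltW.
  by rewrite integral_indic// setIT [X in (_ * X + _)%E]Pk -!EFinM -EFinD.
rewrite -lee_fin EFinM -(prE P mA).
rewrite -sumEFin; under eq_bigr do rewrite -Eh.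
rewrite -ge0_integral_sum//=; do ?[by move=> k; apply/measurable_EFinP
  |by move=> k t _; rewrite lee_fin].
have -> : (D%:E * P A = \int[P]_(t in A) (cst D%:E t))%E by rewrite integral_cst.
rewrite integral_mkcond; apply: ge0_le_integral => //.
- by move=> t _; rewrite erestrict_ge0// => x _; rewrite lee_fin.
- by apply/(measurable_restrictT _ mA).
- by apply: emeasurable_sum => k; apply/measurable_EFinP.
move=> t _; rewrite sumEFin patchE; case: ifPn => [|_]; last first.
  by rewrite lee_fin sumr_ge0.
rewrite inE => At; rewrite lee_fin.
have [sU|] := pselect (forall k, s k < U k t).
  apply: le_trans (hA t At sU) _; apply: ler_sum => k _.
  rewrite /h ler_wpDl ?mulr_ge0//; apply: ler_wpM2l => //.
  by rewrite ge_max g0 /= /g (ltW (sU k)).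
move=> /existsNP[k /negP]; rewrite -leNgt => Us.
rewrite (bigD1 k)//= ler_wpDr ?sumr_ge0// /h indicE mem_set//= mulr1.
by rewrite ler_wpDr// mulr_ge0.
Qed.

End attain.

(** * Weighted power means *)

Section mean.
Context {R : realType}.

Lemma max_weightP (K : nat) (w : K.-tuple R) : (0 < K)%N -> (forall k, 0 <= tnth w k) ->
  (forall k, tnth w k <= max_weight w) /\ exists k, tnth w k = max_weight w.
Proof.
move=> K0 w0; rewrite /max_weight; split=> [k|].
  by apply: (bigmax_sup k).
have [k _ hk] := @arg_maxP _ _ _ (Ordinal K0) xpredT (tnth w) isT.
exists k; apply/le_anti; rewrite (bigmax_sup k)//=.
by apply: bigmax_le => // j _; exact: hk.
Qed.

(** The power mean of exponent [r] is the quasi-arithmetic mean of [phi r], which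
    is decreasing on the positive reals for every sign of [r]; [Phi r] is the
    primitive of it that vanishes at 0. *)
Definition phi (r u : R) : R := if r == 0 then - ln u else - (u `^ r / r).
Definition Phi (r u : R) : R :=
  if r == 0 then u - u * ln u else - (u `^ (r + 1) / (r * (r + 1))).

(** The mean of [phi r - phi r e] over [[0, e]], as [gapE] shows. *)
Definition gap (r e : R) : R := e `^ r / (r + 1).

Lemma gapE (e r : R) : 0 < e -> -1 < r -> Phi r e = e * (gap r e + phi r e).
Proof.
move=> e0 r1; rewrite /Phi /gap /phi; case: eqP => [->|/eqP r0].
  by rewrite powRr0 add0r divr1; ring.
have h1 : r + 1 != 0 by rewrite gt_eqF//; lra.
rewrite -(@mulr_powRB1 _ e (r + 1)) ?(ltW e0)//; last lra.
by rewrite addrK; field; rewrite r0.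
Qed.

Lemma measurable_phi (r : R) : measurable_fun setT (phi r).
Proof.
rewrite /phi; case: eqP => _.
  by apply: measurableT_comp => //; exact: measurable_ln.
apply: measurableT_comp => //; apply: measurable_funM => //.
Qed.

Lemma derivable_phi (r x : R) : 0 < x -> derivable (phi r) x 1.
Proof.
move=> x0; rewrite /phi; case: eqP => [_|_].
  by apply: derivableN; have [] := is_derive1_ln x0.
apply: derivableN; apply: derivableM => //.
by apply: derivable_powR; rewrite in_itv /= x0.
Qed.

Lemma is_derive_Phi (r x : R) : -1 < r -> 0 < x -> is_derive x 1 (Phi r) (phi r x).
Proof.
move=> r1 x0; rewrite /Phi /phi; case: eqP => [_|/eqP r0].
  apply: (is_derive_eq (is_deriveB (is_derive_id x 1)
    (is_deriveM (is_derive_id x 1) (is_derive1_ln x0)))).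
  rewrite -[_ *: _ + _]/(x * x^-1 + ln x * 1) mulfV ?gt_eqF// mulr1; ring.
have h1 : r + 1 != 0 by rewrite gt_eqF//; lra.
apply: (is_derive_eq (is_deriveN (is_deriveM (is_derive1_powR (r + 1) x0)
  (is_derive_cst (r * (r + 1))^-1 x 1)))).
rewrite scaler0 add0r addrK; congr (- _).
rewrite -[_ *: _]/((r * (r + 1))^-1 * ((r + 1) * x `^ r)); field.
by rewrite r0.
Qed.

Lemma phi_nonincreasing (r x e : R) : 0 < x -> x <= e -> phi r e <= phi r x.
Proof.
move=> x0 xe; have e0 : 0 < e by exact: lt_le_trans xe.
rewrite /phi; case: eqP => [_|/eqP r0].
  by rewrite lerN2 ler_ln.
rewrite lerN2; have [rp|rn] := ltP 0 r.
  by rewrite ler_pM2r ?invr_gt0//; apply: ge0_powR_le => //; exact: ltW.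
have {}rn : r < 0 by rewrite lt_neqAle r0.
rewrite ler_nM2r ?invr_lt0//.
have rV (y : R) : y `^ r = (y `^ (- r))^-1 by rewrite powRN invrK.
rewrite !rV lef_pV2 ?posrE ?powR_gt0//.
by apply: ge0_powR_le => //; rewrite ?oppr_ge0 ltW.
Qed.

Lemma epow_pos (x c : R) : 0 < x -> epow x%:E c = (x `^ c)%:E.
Proof.
move=> x0; rewrite /epow; case: ifP => _; last by rewrite poweR_EFin.
by rewrite eqe gt_eqF//= poweR_EFin.
Qed.

Lemma epow_gt0 (x c : R) : 0 < c -> epow x%:E c = (x `^ c)%:E.
Proof. by move=> c0; rewrite /epow (lt_gtF c0) poweR_EFin. Qed.

Lemma sum_EFinM (K : nat) (w p : 'I_K -> R) (F : 'I_K -> \bar R) :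
  (forall k, F k = (p k)%:E) ->
  (\sum_(k < K) (w k)%:E * F k = (\sum_k w k * p k)%:E)%E.
Proof.
by move=> FE; rewrite -sumEFin; apply: eq_bigr => k _; rewrite FE EFinM.
Qed.

Lemma powR_le_inv (r x e : R) : 0 < r -> 0 <= x -> 0 <= e ->
  (x `^ r^-1 <= e) = (x <= e `^ r).
Proof.
move=> r0 x0 e0; have rn0 : r != 0 by rewrite gt_eqF.
apply/idP/idP => h.
  have := ge0_powR_le (ltW r0) (powR_ge0 _ _) h.
  by rewrite -powRrM mulVf// powRr1.
have := @ge0_powR_le R r^-1 _ _ (ltW _) x0 h; rewrite invr_gt0 => /(_ r0).
by rewrite -powRrM mulfV// powRr1.
Qed.

Lemma scaled_meanE (K : nat) (w p : K.-tuple R) (r : R) : 0 < r ->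
  scaled_mean r w p =
  ((r + 1) `^ r^-1 * (\sum_k tnth w k * tnth p k `^ r) `^ r^-1)%:E.
Proof.
move=> r0; rewrite /scaled_mean /mean_factor /gen_mean gt_eqF//.
rewrite (@sum_EFinM _ (tnth w) (fun k => tnth p k `^ r)); last first.
  by move=> k; rewrite epow_gt0.
by rewrite epow_gt0 ?invr_gt0// -EFinM.
Qed.

Lemma scaled_mean_le (K : nat) (w p : K.-tuple R) (r e : R) : 0 < r -> 0 <= e ->
  (forall k, 0 <= tnth w k) ->
  (scaled_mean r w p <= e%:E)%E = (\sum_k tnth w k * tnth p k `^ r <= gap r e).
Proof.
move=> r0 e0 w0; have rr : 0 < r + 1 by lra.
have S0 : 0 <= \sum_k tnth w k * tnth p k `^ r.
  by apply: sumr_ge0 => k _; rewrite mulr_ge0// powR_ge0.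
rewrite scaled_meanE// lee_fin -powRM ?(ltW rr)// powR_le_inv ?mulr_ge0 ?(ltW rr)//.
by rewrite /gap ler_pdivlMr// mulrC.
Qed.

(** The inequality for the scaled mean turns into one for the mean of [phi],
    through the logarithm for [r = 0] and through the power [r] otherwise, which
    is decreasing for [r < 0] like the division by [r].  Positive arguments
    avoid the infinite values of the conventions at 0. *)
Lemma scaled_mean_phi (K : nat) (w p : K.-tuple R) (r e : R) : -1 < r -> 0 < e ->
  (forall k, 0 <= tnth w k) -> \sum_k tnth w k = 1 ->
  (forall k, 0 < tnth p k) -> (scaled_mean r w p <= e%:E)%E ->
  gap r e + phi r e <= \sum_k tnth w k * phi r (tnth p k).
Proof.
move=> r1 e0 w0 wS p0; have rr : 0 < r + 1 by lra.
have [rE|rn0] := eqVneq r 0.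
  rewrite /scaled_mean /mean_factor /gen_mean /phi /gap rE eqxx.
  rewrite (@sum_EFinM _ (tnth w) (fun k => ln (tnth p k))) => [|k]; last by rewrite lne_EFin.
  rewrite -[expeR _]/((expR (\sum_k tnth w k * ln (tnth p k)))%:E) -EFinM lee_fin -expRD => h.
  have : 1 + \sum_k tnth w k * ln (tnth p k) <= ln e.
    by rewrite -[leLHS]expRK ler_ln ?posrE ?expR_gt0.
  rewrite powRr0 add0r divr1.
  have -> : \sum_k tnth w k * - ln (tnth p k) = - \sum_k tnth w k * ln (tnth p k).
    by rewrite -sumrN; apply: eq_bigr => k _; rewrite mulrN.
  by lra.
pose S := \sum_k tnth w k * tnth p k `^ r.
have S0 : 0 < S.
  rewrite lt_neqAle sumr_ge0 ?andbT; last by move=> k _; rewrite mulr_ge0// powR_ge0.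
  apply/negP => /eqP/esym/eqP; rewrite psumr_eq0; last first.
    by move=> k _; rewrite mulr_ge0// powR_ge0.
  move=> /allP h; have : \sum_k tnth w k = 0.
    apply: big1 => k _; have := h k (mem_index_enum _); rewrite /= mulf_eq0.
    by rewrite [X in _ || X]gt_eqF ?powR_gt0// orbF => /eqP.
  by rewrite wS => /eqP; rewrite oner_eq0.
rewrite /scaled_mean /mean_factor /gen_mean /phi /gap (negbTE rn0).
rewrite (@sum_EFinM _ (tnth w) (fun k => tnth p k `^ r)) => [|k]; last by rewrite epow_pos.
rewrite -/S epow_pos// -EFinM lee_fin -powRM ?(ltW rr) ?(ltW S0)//.
have X0 : 0 < (r + 1) * S by rewrite mulr_gt0.
have -> : \sum_k tnth w k * - (tnth p k `^ r / r) = - (S / r).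
  by rewrite /S mulr_suml -sumrN; apply: eq_bigr => k _; rewrite mulrN mulrA.
have -> : e `^ r / (r + 1) + - (e `^ r / r) = - (e `^ r / (r + 1) / r).
  by field; rewrite rn0 gt_eqF.
rewrite lerN2; have [rp|rn] := ltP 0 r.
  rewrite powR_le_inv ?(ltW X0) ?(ltW e0)// => h.
  by rewrite ler_pM2r ?invr_gt0// ler_pdivlMr// mulrC.
have {}rn : r < 0 by rewrite lt_neqAle rn0.
move=> h; rewrite ler_nM2r ?invr_lt0// ler_pdivrMr// mulrC.
have nr0 : 0 < - r by rewrite oppr_gt0.
have := ge0_powR_le (ltW nr0) (powR_ge0 _ _) h.
rewrite -powRrM mulrN mulVf// [X in X <= _]powRN (powRr1 (ltW X0)) powRN.
by rewrite lef_pV2 ?posrE ?powR_gt0.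
Qed.

End mean.

(** * Levels that are missed *)

Section bounds.
Context {R : realType} {d : measure_display} {T : measurableType d}.
Context (P : probability T R).
Local Notation pr := (pr P).
Context (K : nat) (w : K.-tuple R).

Definition mean_event (r e : R) (U : 'I_K -> {RV P >-> R}) : set T :=
  [set t | (scaled_mean r w [tuple U k t | k < K] <= e%:E)%E].

Definition missed_level (r e : R) :=
  exists2 b, b < e & forall U : 'I_K -> {RV P >-> R},
    (forall k, uniform01 (U k)) -> measurable (mean_event r e U) ->
    pr (mean_event r e U) <= b.

Lemma measurable_unit_cube : measurable (@unit_cube R K).
Proof.
rewrite [X in measurable X](_ : _ =
  \bigcap_(k in [set: 'I_K]) [set p : K.-tuple R | 0 <= tnth p k <= 1]); last first.
  by apply/seteqP; split => p h k; [move=> _|]; exact: h.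
apply: fin_bigcap_measurable => // k _.
rewrite [X in measurable X](_ : _ = (@tnth K R)^~ k @^-1` `[0, 1]); last first.
  by apply/seteqP; split => p /=; rewrite in_itv.
by rewrite -[X in measurable X]setTI; apply: measurable_tnth => //; exact: measurable_itv.
Qed.

Lemma measurable_mean_event (r e : R) (U : 'I_K -> {RV P >-> R}) :
  measurable_fun (@unit_cube R K) (scaled_mean r w) ->
  (forall k, uniform01 (U k)) -> measurable (mean_event r e U).
Proof.
move=> mF hU.
have mU : measurable_fun setT (fun t => [tuple U k t | k < K]).
  apply/measurable_fun_tnthP => k.
  rewrite (_ : _ \o _ = U k); first by [].
  by apply/funext => t /=; rewrite tnth_mktuple.
pose D := @unit_cube R K `&` scaled_mean r w @^-1` `]-oo, e%:E].
have mD : measurable D by apply: mF; [exact: measurable_unit_cube|exact: emeasurable_itv].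
rewrite [X in measurable X](_ : _ = (fun t => [tuple U k t | k < K]) @^-1` D).
  by rewrite -[X in measurable X]setTI; exact: mU.
apply/seteqP; split => t /=; rewrite /mean_event /D /= in_itv /=; last by case.
move=> h; split => // k; rewrite tnth_mktuple; by case: (hU k).
Qed.

Context (w0 : forall k, 0 <= tnth w k) (wS : \sum_k tnth w k = 1).

(** The integral of [phi r - phi r e] over [[0, s]], by [gapE]. *)
Definition loss (r e s : R) := s * (gap r s + (phi r s - phi r e)).

Lemma loss_ge0 (r e s : R) : -1 < r -> 0 < s -> s <= e -> 0 <= loss r e s.
Proof.
move=> r1 s0 se; rewrite /loss mulr_ge0 ?(ltW s0)// addr_ge0//.
  by rewrite /gap divr_ge0 ?powR_ge0//; lra.
by rewrite subr_ge0 phi_nonincreasing.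
Qed.

Lemma gap_gt0 (e r : R) : -1 < r -> 0 < e -> 0 < gap r e.
Proof. by move=> r1 e0; rewrite /gap divr_gt0 ?powR_gt0//; lra. Qed.

(** This is [dual_bound] for [phi r]; [e * gap r e] is the integral of
    [phi r - phi r e] over [[0, e]]. *)
Lemma mean_event_bound (r e : R) (U : 'I_K -> {RV P >-> R}) (s : 'I_K -> R) :
  -1 < r -> 0 < e < 1 -> (forall k, uniform01 (U k)) ->
  measurable (mean_event r e U) -> (forall k, 0 < s k < e) ->
  gap r e * pr (mean_event r e U) <=
    e * gap r e + \sum_k (gap r e * s k - tnth w k * loss r e (s k)).
Proof.
move=> r1 /andP[e0 e1] hU mA se.
have D0 := gap_gt0 r1 e0.
have := @dual_bound _ _ _ P K U (tnth w) s (phi r) (Phi r) e (gap r e) _ hU w0 mA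
  (measurable_phi r) (ltW e1) se (ltW D0)
  (fun x x0 => is_derive_Phi r1 x0) (fun x => @derivable_phi _ r x)
  (fun x => @phi_nonincreasing _ r x e).
move=> h; apply: le_trans (h _) _ => [t At sU|].
  have U0 k : 0 < U k t by case/andP: (se k) => s0 _; exact: lt_trans (sU k).
  have := @scaled_mean_phi _ K w [tuple U k t | k < K] r e r1 e0 w0 wS.
  have p0 k : 0 < tnth [tuple U k t | k < K] k by rewrite tnth_mktuple.
  move=> /(_ p0 At) hphi.
  apply: (@le_trans _ _ (\sum_k tnth w k * (phi r (U k t) - phi r e))).
    have -> : \sum_k tnth w k * (phi r (U k t) - phi r e)
      = \sum_k tnth w k * phi r (tnth [tuple U k t | k < K] k) - phi r e.
      have -> : phi r e = \sum_k tnth w k * phi r e by rewrite -mulr_suml wS mul1r.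
      by rewrite -sumrB; apply: eq_bigr => k _; rewrite tnth_mktuple mulrBr -mulr_suml wS mul1r.
    by lra.
  apply: ler_sum => k _; apply: ler_wpM2l => //; rewrite le_max.
  case: ifP => [_|/negbT]; first by rewrite lexx orbT.
  by rewrite -ltNge => eU; rewrite subr_le0 phi_nonincreasing// ltW.
rewrite le_eqVlt; apply/orP; left; apply/eqP.
have -> : e * gap r e = \sum_k tnth w k * (e * gap r e) by rewrite -mulr_suml wS mul1r.
rewrite -big_split /=; apply: eq_bigr => k _; rewrite (gapE e0 r1).
by have /andP[sk0 _] := se k; rewrite (gapE sk0 r1) /loss; ring.
Qed.

(** All [s k] tend to 0. *)
Lemma mean_event_le (r e : R) (U : 'I_K -> {RV P >-> R}) :
  -1 < r -> 0 < e < 1 -> (forall k, uniform01 (U k)) ->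
  measurable (mean_event r e U) -> pr (mean_event r e U) <= e.
Proof.
move=> r1 e01 hU mA; have /andP[e0 e1] := e01.
have D0 := gap_gt0 r1 e0.
apply/ler_addgt0Pr => z z0.
pose s := Num.min (e / 2) (z / K.+1%:R).
have K0 : 0 < K.+1%:R :> R by [].
have s0 : 0 < s by rewrite lt_min !divr_gt0.
have se : s < e by rewrite gt_min; apply/orP; left; lra.
have h := @mean_event_bound r e U (fun=> s) r1 e01 hU mA.
rewrite -(ler_pM2l D0); apply: le_trans (h _) _; first by move=> k; rewrite s0.
rewrite mulrDr [e * _]mulrC lerD2l.
apply: (@le_trans _ _ (\sum_(k < K) gap r e * s)).
  by apply: ler_sum => k _; rewrite gerBl mulr_ge0// loss_ge0// ltW.
rewrite sumr_const card_ord -mulrnAr ler_pM2l// -mulr_natr.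
have : s * K.+1%:R <= z by rewrite -ler_pdivlMr// ge_min lexx orbT.
by apply: le_trans; rewrite ler_pM2l// ler_nat.
Qed.

(** Since [phi r] is unbounded at 0, [loss r e s] exceeds [M * s] for any [M]
    and suitable small [s]; with all [s k] equal to this [s] the losses, of total
    weight 1, outweigh the cost [K * gap * s]. *)
Lemma mean_event_lt_nonpos (r e : R) : -1 < r -> r <= 0 -> 0 < e < 1 -> missed_level r e.
Proof.
move=> r1 r0 e01; have /andP[e0 e1] := e01.
have D0 := gap_gt0 r1 e0; have rr : 0 < r + 1 by lra.
pose M := K%:R * gap r e + 1.
have M0 : 0 < M by rewrite /M ltr_wpDl// mulr_ge0// ltW.
have [s [s0 se hs]] : exists s, [/\ 0 < s, s < e & M <= gap r s + (phi r s - phi r e)].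
  have [rE|rn0] := eqVneq r 0.
    exists (Num.min (e / 2) (e * expR (- M))); split.
    - by rewrite lt_min divr_gt0// mulr_gt0// expR_gt0.
    - by rewrite gt_min; apply/orP; left; lra.
    set s := Num.min _ _.
    have s0 : 0 < s by rewrite lt_min divr_gt0// mulr_gt0// expR_gt0.
    have : ln s <= ln e - M.
      rewrite -[- M]expRK -lnM ?posrE ?expR_gt0// ler_ln ?posrE ?mulr_gt0 ?expR_gt0//.
      by rewrite ge_min lexx orbT.
    have := gap_gt0 r1 s0; rewrite /phi rE eqxx; lra.
  have rn : r < 0 by rewrite lt_neqAle rn0.
  pose X := M * (r + 1); have X0 : 0 < X by rewrite mulr_gt0.
  exists (Num.min (e / 2) (X `^ r^-1)); split.
  - by rewrite lt_min divr_gt0// powR_gt0.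
  - by rewrite gt_min; apply/orP; left; lra.
  set s := Num.min _ _.
  have s0 : 0 < s by rewrite lt_min divr_gt0// powR_gt0.
  have se : s <= e by rewrite ge_min; apply/orP; left; lra.
  have : M <= gap r s.
    rewrite /gap ler_pdivlMr// -/X.
    have sX : s <= X `^ r^-1 by rewrite ge_min lexx orbT.
    have nr : 0 <= - r by rewrite oppr_ge0.
    have := ge0_powR_le nr (ltW s0) sX.
    rewrite -powRrM mulrN mulVf// [X in _ <= X]powRN (powRr1 (ltW X0)) powRN.
    by rewrite lef_pV2 ?posrE ?powR_gt0.
  by have := phi_nonincreasing r s0 se; lra.
exists (e - s / gap r e); first by rewrite gtrBl divr_gt0.
move=> U hU mA; have := @mean_event_bound r e U (fun=> s) r1 e01 hU mA.
move=> /(_ (fun=> introT andP (conj s0 se))) h.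
rewrite -(ler_pM2l D0); apply: le_trans h _.
rewrite sumrB sumr_const card_ord -mulr_suml wS mul1r mulrBr.
rewrite [gap r e * (s / _)]mulrCA mulfV ?gt_eqF// mulr1 [e * _]mulrC lerD2l.
rewrite -mulr_natl /loss.
have := ler_wpM2l (ltW s0) hs; rewrite /M; lra.
Qed.

(** As [s] tends to 0, [loss r e s / s] tends to [e^r / r], and
    [w_k0 * e^r / r > gap] by hypothesis.  A positive [s] for [k0] alone gains a
    fixed amount, which positive but much smaller [s'] for the other indices do
    not spoil. *)
Lemma mean_event_lt_small (r e : R) (k0 : 'I_K) : 0 < r ->
  r < tnth w k0 * (r + 1) -> 0 < e < 1 -> missed_level r e.
Proof.
move=> r0 hw e01; have /andP[e0 e1] := e01.
have r1 : -1 < r by lra.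
have rr : 0 < r + 1 by lra.
have D0 := gap_gt0 r1 e0.
set v := tnth w k0 in hw.
have v0 : 0 < v.
  rewrite ltNge; apply/negP => v0; have : v * (r + 1) <= 0 by rewrite mulr_le0_ge0// ltW.
  lra.
have er0 : 0 < e `^ r by rewrite powR_gt0.
pose ga := v * (e `^ r / r) - gap r e.
have ga0 : 0 < ga.
  rewrite /ga /gap subr_gt0 ltr_pdivrMr//.
  have -> : v * (e `^ r / r) * (r + 1) = e `^ r * (v * (r + 1) / r) by ring.
  by rewrite ltr_pMr// ltr_pdivlMr// mul1r.
pose X := ga * r / (2 * v); have X0 : 0 < X by rewrite divr_gt0 ?mulr_gt0.
pose s := Num.min (e / 2) (X `^ r^-1).
have s0 : 0 < s by rewrite lt_min divr_gt0// powR_gt0.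
have se : s < e by rewrite gt_min; apply/orP; left; lra.
have sr : s `^ r <= X.
  apply: (@le_trans _ _ ((X `^ r^-1) `^ r)).
    by apply: ge0_powR_le; rewrite ?(ltW r0) ?(ltW s0)// ge_min lexx orbT.
  by rewrite -powRrM mulVf ?gt_eqF// powRr1// ltW.
have hloss : gap r e + ga / 2 <= v * (gap r s + (phi r s - phi r e)).
  have h1 := gap_gt0 r1 s0.
  have h2 : v * (s `^ r / r) <= ga / 2.
    have : v * (s `^ r / r) <= v * (X / r) by rewrite ler_pM2l// ler_pM2r ?invr_gt0.
    have -> : v * (X / r) = ga / 2 by rewrite /X; field; rewrite !gt_eqF.
    by [].
  have h3 : 0 <= v * gap r s by rewrite mulr_ge0 ?ltW.
  have -> : v * (gap r s + (phi r s - phi r e)) =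
      v * gap r s - v * (s `^ r / r) + v * (e `^ r / r) by rewrite /phi gt_eqF//; ring.
  by move: h2; rewrite /ga; lra.
pose z := s * ga / 4; have z0 : 0 < z by rewrite divr_gt0 ?mulr_gt0.
pose s' := Num.min (e / 2) (z / (K.+1%:R * gap r e)).
have K0 : 0 < K.+1%:R * gap r e by rewrite mulr_gt0.
have s'0 : 0 < s' by rewrite lt_min; apply/andP; split; rewrite divr_gt0.
have se' : s' < e by rewrite gt_min; apply/orP; left; lra.
have s'z : K%:R * gap r e * s' <= z.
  have : s' * (K.+1%:R * gap r e) <= z by rewrite -ler_pdivlMr// ge_min lexx orbT.
  have : 0 <= gap r e * s' by rewrite mulr_ge0 ?ltW.
  rewrite -[K.+1%:R]natr1; lra.
exists (e - z / gap r e); first by rewrite gtrBl divr_gt0.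
move=> U hU mA; pose t k := if k == k0 then s else s'.
have te k : 0 < t k < e by rewrite /t; case: ifP => _; rewrite ?s0 ?s'0.
have h := @mean_event_bound r e U t r1 e01 hU mA te.
rewrite -(ler_pM2l D0); apply: le_trans h _.
rewrite mulrBr [gap r e * (z / _)]mulrCA mulfV ?gt_eqF// mulr1 [e * _]mulrC lerD2l.
rewrite (bigD1 k0)//= /t eqxx.
have : \sum_(k | k != k0) (gap r e * t k - tnth w k * loss r e (t k)) <= z.
  apply: le_trans s'z; apply: (@le_trans _ _ (\sum_(k < K) gap r e * s')).
    rewrite [leRHS](bigD1 k0)//=; apply: ler_wpDl.
      by rewrite mulr_ge0 ?(ltW D0) ?(ltW s'0).
    apply: ler_sum => k /negbTE kk; rewrite /t kk gerBl mulr_ge0// loss_ge0// ltW//.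
  by rewrite sumr_const card_ord -[_ *+ K]mulr_natl mulrA.
rewrite /t => hsum.
have : s * (gap r e + ga / 2) <= v * loss r e s.
  by rewrite /loss mulrCA ler_pM2l.
rewrite -/v; move: hsum; rewrite /z; lra.
Qed.

(** The term of index [k0] alone forces [w_k0 * U_k0^r <= e^r/(r+1)], hence
    [U_k0 <= q^(1/r)] with [q < e^r]. *)
Lemma mean_event_lt_large (r e : R) (k0 : 'I_K) : 0 < r ->
  1 < tnth w k0 * (r + 1) -> 0 < e < 1 -> missed_level r e.
Proof.
move=> r0 hw /andP[e0 e1]; have rr : 0 < r + 1 by lra.
set v := tnth w k0 in hw.
have v0 : 0 < v.
  rewrite ltNge; apply/negP => v0; have : v * (r + 1) <= 0 by rewrite mulr_le0_ge0// ltW.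
  lra.
have vr0 : 0 < v * (r + 1) by lra.
pose q := (e `^ r / (v * (r + 1))).
have er0 : 0 < e `^ r by rewrite powR_gt0.
have q0 : 0 < q by rewrite divr_gt0.
have qe : q < e `^ r by rewrite ltr_pdivrMr// ltr_pMr.
have bE : q `^ r^-1 < e.
  have -> : e = (e `^ r) `^ r^-1 by rewrite -powRrM mulfV ?gt_eqF// powRr1// ltW.
  by apply: gt0_ltr_powR; rewrite ?nnegrE ?invr_gt0// ltW.
exists (q `^ r^-1) => // U hU mA.
have b01 : 0 <= q `^ r^-1 <= 1 by rewrite powR_ge0 (le_trans (ltW bE))// ltW.
rewrite -[leRHS](uniform01_cdf (hU k0) b01).
apply: pr_le => //; first exact: measurable_le_set.
move=> t; rewrite /mean_event /= scaled_mean_le ?(ltW e0)// => h.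
have Ut0 : 0 <= U k0 t by case: (hU k0) => /(_ t)/andP[].
have hk : v * U k0 t `^ r <= gap r e.
  apply: le_trans h; rewrite (bigD1 k0)//= tnth_mktuple ler_wpDr//.
  by apply: sumr_ge0 => k _; rewrite mulr_ge0// powR_ge0.
have Uq : U k0 t `^ r <= q.
  have -> : q = gap r e / v by rewrite /q /gap; field; rewrite !gt_eqF.
  by rewrite ler_pdivlMr// mulrC.
have := @ge0_powR_le R r^-1 _ _ (ltW _) (powR_ge0 _ _) Uq; rewrite invr_gt0 => /(_ r0).
by rewrite -powRrM mulfV ?gt_eqF// powRr1.
Qed.

End bounds.

(** * Precise merging functions *)

Section main.
Context {R : realType} {d : measure_display} {T : measurableType d}.
Context (P : probability T R).
Local Notation pr := (pr P).
Context (K : nat) (w : K.-tuple R).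

Lemma sup_prob_le_ub (r e b : R) :
  measurable_fun (@unit_cube R K) (scaled_mean r w) ->
  (forall U : 'I_K -> {RV P >-> R}, (forall k, uniform01 (U k)) ->
    measurable (mean_event w r e U) -> pr (mean_event w r e U) <= b) ->
  (sup_prob_le P (scaled_mean r w) e <= b%:E)%E.
Proof.
move=> mF hb; apply: ge_ereal_sup => _ [U hU <-].
have mA := measurable_mean_event e mF hU.
by rewrite -[X in P X]/(mean_event w r e U) (prE P mA) lee_fin hb.
Qed.

Context (w0 : forall k, 0 <= tnth w k) (wS : \sum_k tnth w k = 1).

Lemma measurable_scaled_mean (r : R) : 0 < r ->
  measurable_fun (@unit_cube R K) (scaled_mean r w).
Proof.
move=> r0; rewrite (_ : scaled_mean r w = fun p : K.-tuple R =>
  ((r + 1) `^ r^-1 * (\sum_k tnth w k * tnth p k `^ r) `^ r^-1)%:E); last first.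
  by apply/funext => p; rewrite scaled_meanE.
apply: measurable_funTS; apply/measurable_EFinP; apply: measurable_funM => //.
apply: (measurableT_comp (measurable_powR _)).
apply: measurable_sum => k; apply: measurable_funM => //.
apply: (measurableT_comp (measurable_powR _)).
exact: measurable_tnth.
Qed.

Lemma merging_scaled_mean (r : R) : 0 < r ->
  merging_function P (scaled_mean r w).
Proof.
move=> r0; have r1 : -1 < r by lra.
have S0 (p : K.-tuple R) : 0 <= \sum_k tnth w k * tnth p k `^ r.
  by apply: sumr_ge0 => k _; rewrite mulr_ge0// powR_ge0.
split=> [p _||p q k hp hq hpq hk|e e01].
- by rewrite scaled_meanE// lee_fin ltry mulr_ge0// powR_ge0.
- exact: measurable_scaled_mean.
- rewrite (scaled_meanE w p r0) (scaled_meanE w q r0) lee_fin.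
  apply: ler_wpM2l; first exact: powR_ge0.
  apply: ge0_powR_le; rewrite ?invr_ge0 ?(ltW r0)//.
  apply: ler_sum => j _; apply: ler_wpM2l => //.
  have /andP[p0 _] := hp j.
  apply: ge0_powR_le; rewrite ?(ltW r0)//.
  by have [->//|jk] := eqVneq j k; rewrite hpq.
- apply: sup_prob_le_ub => [|U hU mA]; first exact: measurable_scaled_mean.
  exact: mean_event_le.
Qed.

Lemma precise_scaled_mean (r : R) : atomless P -> (2 <= K)%N -> 0 < r ->
  (forall k, tnth w k * (r + 1) <= 1) -> (forall k, tnth w k * (r + 1) <= r) ->
  precise_merging_function P (scaled_mean r w).
Proof.
move=> hP K2 r0 hw1 hwr; have hM := merging_scaled_mean r0.
split=> // e e01; have /andP[e0 _] := e01.
apply/le_anti/andP; split; first by case: hM => _ _ _; exact.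
apply/lee_addgt0Pr => z z0.
have [U [hU hz]] := near_precise hP K2 w0 wS r0 hw1 hwr e01 z0.
have mA := measurable_mean_event e (measurable_scaled_mean r0) hU.
have AE : mean_event w r e U =
    [set t | \sum_k tnth w k * U k t `^ r <= e `^ r / (r + 1)].
  apply/funext => t; rewrite /mean_event /= scaled_mean_le ?(ltW e0)// /gap.
  by congr (is_true (_ <= _)); apply: eq_bigr => k _; rewrite tnth_mktuple.
apply: (@le_trans _ _ (P (mean_event w r e U) + z%:E)%E).
  by rewrite (prE P mA) -EFinD lee_fin AE; lra.
by rewrite leeD2r//; apply: ereal_sup_ubound; exists U.
Qed.

(** A single missed level refutes preciseness; the level 1/2 serves. *)
Lemma precise_exponent (r : R) : (0 < K)%N -> -1 < r ->
  precise_merging_function P (scaled_mean r w) ->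
  [/\ 0 < r, forall k, tnth w k * (r + 1) <= 1
    & forall k, tnth w k * (r + 1) <= r].
Proof.
move=> K0 r1 [[_ mF _ _] hsup].
have e01 : 0 < (1 / 2 : R) < 1 by lra.
have no_miss : ~ missed_level P w r (1 / 2).
  move=> [b b2 /(sup_prob_le_ub mF)]; rewrite hsup// lee_fin; lra.
have r0 : 0 < r.
  by rewrite ltNge; apply/negP => r0; apply: no_miss; exact: mean_event_lt_nonpos.
split=> // k; rewrite leNgt; apply/negP => h; apply: no_miss.
  exact: mean_event_lt_large h e01.
exact: mean_event_lt_small h e01.
Qed.

End main.

(** The bound [w <= 1/2] follows from adding the two inequalities; conversely it
    makes [1 - w] positive. *)
Lemma exponent_intervalE (R : realFieldType) (w r : R) : 0 < w -> -1 < r ->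
  (w <= 1 / 2 /\ w / (1 - w) <= r <= (1 - w) / w) <->
  [/\ 0 < r, w * (r + 1) <= 1 & w * (r + 1) <= r].
Proof.
move=> w0 r1; split=> [[w2 /andP[]]|[r0 h1 h2]].
  have w1 : 0 < 1 - w by lra.
  rewrite ler_pdivrMr// ler_pdivlMr// => h1 h2.
  split; [|lra|lra].
  have : 0 < r * (1 - w) by lra.
  by rewrite pmulr_lgt0.
have w1 : 0 < 1 - w.
  have : 0 < r * (1 - w) by lra.
  by rewrite pmulr_rgt0.
split; last by rewrite ler_pdivrMr// ler_pdivlMr//; apply/andP; split; lra.
have rr : 0 < r + 1 by lra.
by rewrite -(ler_pM2r rr); lra.
Qed.

Theorem mainTheorem10 (R : realType) (d : measure_display)
    (T : measurableType d) (P : probability T R) (hP : atomless P)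
    (K : nat) (hK : (2 <= K)%N) (wt : K.-tuple R) (hwt : simplex wt)
    (r : R) (hr : -1 < r) :
  let w := max_weight wt in
  precise_merging_function P (scaled_mean r wt) <->
  w <= 1 / 2 /\ w / (1 - w) <= r <= (1 - w) / w.
Proof.
move=> w; have [w01 wS] := hwt.
have w0 k : 0 <= tnth wt k by have /andP[] := w01 k.
have K0 : (0 < K)%N by exact: ltnW.
have [wM [k0 wk0]] := max_weightP K0 w0.
have wpos : 0 < w.
  rewrite ltNge; apply/negP => h; have : \sum_k tnth wt k <= 0.
    by apply: sumr_le0 => k _; exact: le_trans (wM k) h.
  by rewrite wS ler10.
rewrite exponent_intervalE//; split=> [/(precise_exponent w0 wS K0 hr)|].
  by case=> r0 h1 h2; rewrite /w -wk0.
case=> r0 h1 h2; have rr : 0 <= r + 1 by lra.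
apply: precise_scaled_mean => // k.
  exact: le_trans (ler_wpM2r rr (wM k)) h1.
exact: le_trans (ler_wpM2r rr (wM k)) h2.
Qed.
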